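(* Let $R$ be an associative commutative unital ring, and let $\mathcal{C}$ be an $R$-linear triangulated category endowed with a bounded weight structure $w$. I. All virtual $t$-truncations (with respect to $w$) of functors of $R$-finite type (from $\mathcal{C}$) are of $R$-finite type also. II. Assume in addition that $\mathcal{C}$ is $R$-saturated. Then the following statements are valid. 1. For any $i\in\mathbb{Z}$ and $M\in\mathrm{Obj}\,\mathcal{C}$ the functors $\tau^{\le -i}(H_M)$ and $\tau^{\ge -i}(H_M)$ are representable, where $H_M=\mathcal{C}(-,M)$. 2. There exists a $t$-structure $t$ on $\mathcal{C}$ right adjacent to $w$. 3. The heart $\underline{Ht}$ of this $t$ naturally embeds (via $N\mapsto \mathcal{C}(-,N)|_{\underline{Hw}}$) into the category $\mathrm{AddFun}_R(\underline{Hw}^{op},R\text{-}\mathrm{mod})$. This embedding is essentially surjective whenever $R$ is noetherian.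
   Context: Weight structures: a pair $(\mathcal{C}_{w\le 0},\mathcal{C}_{w\ge 0})$ of classes of objects such that: (i) both are closed under retracts in $\mathcal{C}$; (ii) $\mathcal{C}_{w\le 0}\subset \mathcal{C}_{w\le 0}[1]$ and $\mathcal{C}_{w\ge 0}[1]\subset \mathcal{C}_{w\ge 0}$; (iii) $\mathcal{C}(X,Y)=0$ for $X\in\mathcal{C}_{w\le 0}$, $Y\in \mathcal{C}_{w\ge 0}[1]$; (iv) every object $M$ fits in a distinguished triangle $LM\to M\to RM\to LM[1]$ with $LM\in\mathcal{C}_{w\le 0}$, $RM\in \mathcal{C}_{w\ge 0}[1]$. Put $\mathcal{C}_{w\le i}=\mathcal{C}_{w\le 0}[i]$, $\mathcal{C}_{w\ge i}=\mathcal{C}_{w\ge 0}[i]$. The heart $\underline{Hw}$ is the full subcategory on $\mathcal{C}_{w\le 0}\cap\mathcal{C}_{w\ge 0}$. $w$ is bounded if $\bigcup_{i}\mathcal{C}_{w\le i}=\mathrm{Obj}\,\mathcal{C}=\bigcup_i\mathcal{C}_{w\ge i}$. A $t$-structure $t$ (cohomological convention) is right adjacent to $w$ if $\mathcal{C}^{t\le 0}=\mathcal{C}_{w\ge 0}$. For $m\in\mathbb{Z}$ choose distinguished triangles $w_{\le m}M\to M\to w_{\ge m+1}M\to$ with $w_{\le m}M\in\mathcal{C}_{w\le m}$, $w_{\ge m+1}M\in\mathcal{C}_{w\ge m+1}$; for $m<n$ there are unique morphisms of such triangles over $\mathrm{id}_M$ from the $m$-th one to the $n$-th one, giving $w_{\le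 m}M\to w_{\le n}M$ and $w_{\ge m+1}M\to w_{\ge n+1}M$. For a cohomological functor $H$ from $\mathcal{C}$ into an abelian category, the virtual $t$-truncations are the cohomological functors $\tau^{\ge -n}(H)(M)=\mathrm{Im}(H(w_{\le n+1}M)\to H(w_{\le n}M))$ and $\tau^{\le -n}(H)(M)=\mathrm{Im}(H(w_{\ge n}M)\to H(w_{\ge n-1}M))$, $n\in\mathbb{Z}$ (they do not depend on choices). An $R$-linear cohomological functor $H$ from $\mathcal{C}$ into $R$-modules is of $R$-finite type if for every $M\in\mathrm{Obj}\,\mathcal{C}$ the $R$-module $H(M)$ is finitely generated and $H(M[i])=0$ for almost all $i\in\mathbb{Z}$. $\mathcal{C}$ is $R$-saturated if the representable functors from $\mathcal{C}$ are exactly all the functors of $R$-finite type. $\mathrm{AddFun}_R(C,D)$ is the category of $R$-linear functors from $C$ to $D$; $R\text{-}\mathrm{mod}$ is the category of finitely generated $R$-modules. ''Embeds'' means: via a fully faithful functor. *)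

(* Defs.v *)
From HB Require Import structures.
From mathcomp Require Import all_boot all_order all_algebra.
From mathcomp Require Import boolp.

Set Implicit Arguments.
Unset Strict Implicit.
Unset Printing Implicit Defensive.

Import Order.TTheory GRing.Theory Num.Theory.
Local Open Scope ring_scope.
#[local] Obligation Tactic := idtac.

(* R is a [comPzRingType] throughout, so the zero ring is not excluded. *)

Section Modules.
Variable R : comPzRingType.

Definition fin_gen (V : lmodType R) : Prop :=
  exists (n : nat) (e : 'I_n -> V),
    forall v, exists a : 'I_n -> R, v = \sum_i a i *: e i.

Definition is_ideal (I : R -> Prop) : Prop :=
  [/\ I 0, forall x y, I x -> I y -> I (x + y) & forall a x, I x -> I (a * x)].

Definition noetherian : Prop :=
  forall I : R -> Prop, is_ideal I ->
    exists (n : nat) (e : 'I_n -> R),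
      (forall i, I (e i)) /\
      forall x, I x -> exists a : 'I_n -> R, x = \sum_i a i * e i.

Section Image.
Variables (U V : lmodType R) (f : {linear U -> V}).

Definition im_pred : {pred V} := fun y => `[< exists x, f x = y >].

Lemma im_submod : submod_closed im_pred.
Proof.
split; first by apply/asboolP; exists 0; rewrite linear0.
move=> a u v /asboolP [x <-] /asboolP [y <-].
by apply/asboolP; exists (a *: x + y); rewrite linearP.
Qed.

HB.instance Definition _ := GRing.isSubmodClosed.Build R V im_pred im_submod.

Record im := Im { im_val : V; _ : im_val \in im_pred }.
HB.instance Definition _ := [isSub for im_val].
HB.instance Definition _ := [Choice of im by <:].
HB.instance Definition _ := [SubChoice_isSubLmodule of im by <:].
End Image.

Lemma im_in (U V : lmodType R) (f : {linear U -> V}) (x : U) :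
  f x \in im_pred f.
Proof. by apply/asboolP; exists x. Qed.

Lemma imE (U V : lmodType R) (f : {linear U -> V}) (y : im f) :
  exists x, f x = val y.
Proof. by case: y => y /= /asboolP. Qed.

Section ImageMap.
Variables (U V U' V' : lmodType R).
Variables (f : {linear U -> V}) (f' : {linear U' -> V'}) (k : {linear V -> V'}).
Hypothesis kP : forall x, exists x', f' x' = k (f x).

Lemma im_map_subproof (y : im f) : k (val y) \in im_pred f'.
Proof. by case: (imE y) => x <-; apply/asboolP. Qed.

Definition im_map (y : im f) : im f' := Im (im_map_subproof y).

Lemma im_map_linear : linear im_map.
Proof. by move=> a u v; apply: val_inj; rewrite /= linearP. Qed.

HB.instance Definition _ := GRing.isLinear.Build R (im f) (im f') _ im_map
  im_map_linear.

Definition im_lin : {linear im f -> im f'} := im_map.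
End ImageMap.
End Modules.

(* Categories without linear structure: the homs live in an unconstrained
   universe, so that categories of functors on a [lincat] are instances. *)
Record category := Category {
  cobj :> Type;
  chom : cobj -> cobj -> Type;
  cid1 : forall X, chom X X;
  ccomp : forall X Y Z, chom Y Z -> chom X Y -> chom X Z;
  ccomp1m : forall X Y (f : chom X Y), ccomp (cid1 Y) f = f;
  ccompm1 : forall X Y (f : chom X Y), ccomp f (cid1 X) = f;
  ccompA : forall X Y Z T (h : chom Z T) (g : chom Y Z) (f : chom X Y),
    ccomp h (ccomp g f) = ccomp (ccomp h g) f
}.
Arguments cid1 {c} X.

Definition ciso (C : category) (X Y : C) : Prop :=
  exists (f : chom X Y) (g : chom Y X),
    ccomp g f = cid1 X /\ ccomp f g = cid1 Y.

Definition cfullsub (C : category) (P : C -> Prop) : category :=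
  @Category {X : C | P X} (fun X Y => chom (sval X) (sval Y))
    (fun X => cid1 (sval X)) (fun X Y Z g f => ccomp g f)
    (fun X Y => @ccomp1m C (sval X) (sval Y))
    (fun X Y => @ccompm1 C (sval X) (sval Y))
    (fun X Y Z T => @ccompA C (sval X) (sval Y) (sval Z) (sval T)).

Record functor (C D : category) := Functor {
  Fobj :> C -> D;
  Fmor : forall X Y : C, chom X Y -> chom (Fobj X) (Fobj Y);
  Fmor1 : forall X : C, Fmor (cid1 X) = cid1 (Fobj X);
  FmorM : forall (X Y Z : C) (g : chom Y Z) (f : chom X Y),
    Fmor (ccomp g f) = ccomp (Fmor g) (Fmor f)
}.

Definition fully_faithful (C D : category) (F : functor C D) : Prop :=
  forall X Y : C, bijective (@Fmor C D F X Y).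

Definition ess_surj (C D : category) (F : functor C D) : Prop :=
  forall Y : D, exists X : C, ciso (F X) Y.

Record lincat (R : comPzRingType) := LinCat {
  lobj :> Type;
  mor : lobj -> lobj -> lmodType R;
  lid : forall X, mor X X;
  lcomp : forall X Y Z, mor Y Z -> mor X Y -> mor X Z;
  lcomp1m : forall X Y (f : mor X Y), lcomp (lid Y) f = f;
  lcompm1 : forall X Y (f : mor X Y), lcomp f (lid X) = f;
  lcompA : forall X Y Z T (h : mor Z T) (g : mor Y Z) (f : mor X Y),
    lcomp h (lcomp g f) = lcomp (lcomp h g) f;
  lcomp_linl : forall X Y Z (a : R) (g g' : mor Y Z) (f : mor X Y),
    lcomp (a *: g + g') f = a *: lcomp g f + lcomp g' f;
  lcomp_linr : forall X Y Z (a : R) (g : mor Y Z) (f f' : mor X Y),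
    lcomp g (a *: f + f') = a *: lcomp g f + lcomp g f'
}.
Arguments lid {R l} X.

Notation "g \oc f" := (lcomp g f) (at level 40, left associativity).

Definition cat_of (R : comPzRingType) (C : lincat R) : category :=
  @Category C (fun X Y => mor X Y) (@lid R C) (@lcomp R C)
    (@lcomp1m R C) (@lcompm1 R C) (@lcompA R C).

Section LinCat.
Variable R : comPzRingType.

Section Iso.
Variable C : lincat R.

Definition is_isom (X Y : C) (f : mor X Y) : Prop :=
  exists g : mor Y X, g \oc f = lid X /\ f \oc g = lid Y.

Definition isomorphic (X Y : C) : Prop := exists f : mor X Y, is_isom f.

Definition is_zero (Z : C) : Prop :=
  forall X : C, (forall f : mor X Z, f = 0) /\ (forall f : mor Z X, f = 0).

Definition is_biprod (X Y B : C) : Prop :=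
  exists (i1 : mor X B) (i2 : mor Y B) (p1 : mor B X) (p2 : mor B Y),
    [/\ p1 \oc i1 = lid X, p2 \oc i2 = lid Y, p1 \oc i2 = 0, p2 \oc i1 = 0
      & i1 \oc p1 + i2 \oc p2 = lid B].

Definition retract_closed (P : C -> Prop) : Prop :=
  forall (X Y : C) (i : mor Y X) (p : mor X Y), p \oc i = lid Y -> P X -> P Y.

Definition iso_closed (P : C -> Prop) : Prop :=
  forall X Y : C, isomorphic X Y -> P X -> P Y.

Definition fullsub (P : C -> Prop) : lincat R :=
  @LinCat R {X : C | P X} (fun X Y => mor (sval X) (sval Y))
    (fun X => lid (sval X)) (fun X Y Z g f => g \oc f)
    (fun X Y => @lcomp1m R C (sval X) (sval Y))
    (fun X Y => @lcompm1 R C (sval X) (sval Y))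
    (fun X Y Z T => @lcompA R C (sval X) (sval Y) (sval Z) (sval T))
    (fun X Y Z => @lcomp_linl R C (sval X) (sval Y) (sval Z))
    (fun X Y Z => @lcomp_linr R C (sval X) (sval Y) (sval Z)).
End Iso.

Record lfunctor (C D : lincat R) := LFunctor {
  fobj :> C -> D;
  fmor : forall X Y : C, mor X Y -> mor (fobj X) (fobj Y);
  fmor1 : forall X : C, fmor (lid X) = lid (fobj X);
  fmorM : forall (X Y Z : C) (g : mor Y Z) (f : mor X Y),
    fmor (g \oc f) = fmor g \oc fmor f;
  fmor_lin : forall (X Y : C) (a : R) (f g : mor X Y),
    fmor (a *: f + g) = a *: fmor f + fmor g
}.

Definition lf_id (C : lincat R) : lfunctor C C :=
  @LFunctor C C id (fun _ _ f => f) (fun _ => erefl) (fun _ _ _ _ _ => erefl)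
    (fun _ _ _ _ _ => erefl).

Program Definition lf_comp (C D E : lincat R) (G : lfunctor D E)
    (F : lfunctor C D) : lfunctor C E :=
  @LFunctor C E (fun X => G (F X)) (fun X Y f => fmor G (fmor F f)) _ _ _.
Next Obligation. by move=> C D E G F X; rewrite /= !fmor1. Qed.
Next Obligation. by move=> C D E G F X Y Z g f; rewrite /= !fmorM. Qed.
Next Obligation. by move=> C D E G F X Y a f g; rewrite /= !fmor_lin. Qed.

Definition nat_iso (C D : lincat R) (F G : lfunctor C D) : Prop :=
  exists a : forall X, mor (F X) (G X),
    (forall X, is_isom (a X)) /\
    (forall X Y (f : mor X Y), a Y \oc fmor F f = fmor G f \oc a X).

Record modfun (C : lincat R) := ModFun {
  mobj :> C -> lmodType R;
  mmor : forall X Y : C, mor X Y -> {linear mobj Y -> mobj X};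
  mmor1 : forall (X : C) (x : mobj X), mmor (lid X) x = x;
  mmorM : forall (X Y Z : C) (g : mor Y Z) (f : mor X Y) (z : mobj Z),
    mmor (g \oc f) z = mmor f (mmor g z);
  mmor_lin : forall (X Y : C) (a : R) (f g : mor X Y) (y : mobj Y),
    mmor (a *: f + g) y = a *: mmor f y + mmor g y
}.

Section Precomp.
Variables (C : lincat R) (M X Y : C) (f : mor X Y).
Definition precomp (u : mor Y M) : mor X M := u \oc f.
Lemma precomp_linear : linear precomp.
Proof. by move=> a u v; rewrite /precomp lcomp_linl. Qed.
HB.instance Definition _ :=
  GRing.isLinear.Build R (mor Y M) (mor X M) _ precomp precomp_linear.
End Precomp.

Program Definition yoneda (C : lincat R) (M : C) : modfun C :=
  @ModFun C (fun X => mor X M) (fun X Y f => @precomp C M X Y f) _ _ _.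
Next Obligation. by move=> C M X x; apply: lcompm1. Qed.
Next Obligation. by move=> C M X Y Z g f z; apply: lcompA. Qed.
Next Obligation. by move=> C M X Y a f g y; apply: lcomp_linr. Qed.

Definition restr (C : lincat R) (P : C -> Prop) (F : modfun C) :
    modfun (fullsub P) :=
  @ModFun (fullsub P) (fun X => F (sval X))
    (fun X Y f => @mmor C F (sval X) (sval Y) f)
    (fun X => @mmor1 C F (sval X))
    (fun X Y Z => @mmorM C F (sval X) (sval Y) (sval Z))
    (fun X Y => @mmor_lin C F (sval X) (sval Y)).

Section NTrans.
Variable C : lincat R.

Record ntrans (F G : modfun C) := NTrans {
  nt :> forall X : C, F X -> G X;
  nt_lin : forall (X : C) (a : R) (x y : F X),
    nt (a *: x + y) = a *: nt x + nt y;
  nt_nat : forall (X Y : C) (f : mor X Y) (y : F Y),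
    nt (mmor F f y) = mmor G f (nt y)
}.

Lemma ntransP (F G : modfun C) (s t : ntrans F G) :
  (forall X (x : F X), s X x = t X x) -> s = t.
Proof.
case: s t => [s sl sn] [t tl tn] /= st.
have e : s = t by apply: functional_extensionality_dep => X; apply: funext.
by case: _ / e tl tn => tl tn; congr NTrans; apply: Prop_irrelevance.
Qed.

Definition nt_id (F : modfun C) : ntrans F F :=
  @NTrans F F (fun X x => x) (fun _ _ _ _ => erefl) (fun _ _ _ _ => erefl).

Program Definition nt_comp (F G H : modfun C) (t : ntrans G H)
    (s : ntrans F G) : ntrans F H :=
  @NTrans F H (fun X x => t X (s X x)) _ _.
Next Obligation. by move=> F G H t s X a x y; rewrite /= !nt_lin. Qed.
Next Obligation. by move=> F G H t s X Y f y; rewrite /= !nt_nat. Qed.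

Program Definition modfun_cat : category :=
  @Category (modfun C) ntrans nt_id nt_comp _ _ _.
Next Obligation. by move=> F G f; apply: ntransP. Qed.
Next Obligation. by move=> F G f; apply: ntransP. Qed.
Next Obligation. by move=> F G H K h g f; apply: ntransP. Qed.

Definition representable (F : modfun C) : Prop :=
  exists N : C, @ciso modfun_cat (yoneda N) F.

(* AddFun_R(C^op, R-mod), the full subcategory of [modfun_cat] given by the
   functors whose values are finitely generated. *)
Definition fg_modfun_cat : category :=
  cfullsub (fun F : modfun_cat => forall X : C, fin_gen ((F : modfun C) X)).
End NTrans.

Program Definition yoneda_map (C : lincat R) (M N : C) (f : mor M N) :
    ntrans (yoneda M) (yoneda N) :=
  @NTrans C (yoneda M) (yoneda N) (fun X (u : mor X M) => f \oc u) _ _.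
Next Obligation. by move=> C M N f X a x y /=; rewrite lcomp_linr. Qed.
Next Obligation. by move=> C M N f X Y g y /=; rewrite /precomp lcompA. Qed.

Definition restr_map (C : lincat R) (P : C -> Prop) (F G : modfun C)
    (s : ntrans F G) : ntrans (restr P F) (restr P G) :=
  @NTrans (fullsub P) (restr P F) (restr P G)
    (fun X => @nt C F G s (sval X)) (fun X => @nt_lin C F G s (sval X))
    (fun X Y => @nt_nat C F G s (sval X) (sval Y)).

(* N |-> C(-, N)|_Q, as a functor from the full subcategory on P into
   AddFun_R(Q^op, R-mod); [fg] says that it does land in R-mod. *)
Program Definition restr_yoneda (C : lincat R) (P Q : C -> Prop)
    (fg : forall N X : C, P N -> Q X -> fin_gen (mor X N)) :
    functor (cat_of (fullsub P)) (fg_modfun_cat (fullsub Q)) :=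
  @Functor (cat_of (fullsub P)) (fg_modfun_cat (fullsub Q))
    (fun N => exist _ (restr Q (yoneda (sval N)))
                (fun X => fg (sval N) (sval X) (proj2_sig N) (proj2_sig X)))
    (fun N N' f => restr_map Q (@yoneda_map C (sval N) (sval N') f)) _ _.
Next Obligation.
by move=> C P Q fg N; apply: ntransP => X x; apply: lcomp1m.
Qed.
Next Obligation.
by move=> C P Q fg N N' N'' g f; apply: ntransP => X x /=; rewrite lcompA.
Qed.
End LinCat.

(* The shift is an R-linear auto-equivalence with a chosen quasi-inverse; a
   strict automorphism is a special case. *)
Record triangulated (R : comPzRingType) := Triangulated {
  tcat :> lincat R;
  has_zero : exists Z : tcat, is_zero Z;
  has_biprod : forall X Y : tcat, exists B : tcat, is_biprod X Y B;
  sus : lfunctor tcat tcat;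
  desus : lfunctor tcat tcat;
  sus_desus : nat_iso (lf_comp sus desus) (lf_id tcat);
  desus_sus : nat_iso (lf_comp desus sus) (lf_id tcat);
  dist : forall X Y Z : tcat,
    mor X Y -> mor Y Z -> mor Z (sus X) -> Prop;
  dist_iso : forall (X Y Z X' Y' Z' : tcat)
    (f : mor X Y) (g : mor Y Z) (h : mor Z (sus X))
    (f' : mor X' Y') (g' : mor Y' Z') (h' : mor Z' (sus X'))
    (a : mor X X') (b : mor Y Y') (c : mor Z Z'),
    is_isom a -> is_isom b -> is_isom c ->
    b \oc f = f' \oc a -> c \oc g = g' \oc b -> fmor sus a \oc h = h' \oc c ->
    dist f g h -> dist f' g' h';
  dist_id : forall X Z : tcat, is_zero Z ->
    dist (lid X) (0 : mor X Z) (0 : mor Z (sus X));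
  dist_cone : forall (X Y : tcat) (f : mor X Y),
    exists (Z : tcat) (g : mor Y Z) (h : mor Z (sus X)), dist f g h;
  dist_rot : forall (X Y Z : tcat)
    (f : mor X Y) (g : mor Y Z) (h : mor Z (sus X)),
    dist f g h <-> dist g h (- fmor sus f);
  dist_mor : forall (X Y Z X' Y' Z' : tcat)
    (f : mor X Y) (g : mor Y Z) (h : mor Z (sus X))
    (f' : mor X' Y') (g' : mor Y' Z') (h' : mor Z' (sus X'))
    (a : mor X X') (b : mor Y Y'),
    dist f g h -> dist f' g' h' -> b \oc f = f' \oc a ->
    exists c : mor Z Z', c \oc g = g' \oc b /\ fmor sus a \oc h = h' \oc c;
  dist_octahedron : forall (X Y Z Q1 Q2 Q3 : tcat)
    (f : mor X Y) (p1 : mor Y Q1) (d1 : mor Q1 (sus X))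
    (g : mor Y Z) (p2 : mor Z Q2) (d2 : mor Q2 (sus X))
    (p3 : mor Z Q3) (d3 : mor Q3 (sus Y)),
    dist f p1 d1 -> dist (g \oc f) p2 d2 -> dist g p3 d3 ->
    exists (a : mor Q1 Q2) (b : mor Q2 Q3),
      [/\ dist a b (fmor sus p1 \oc d3),
          a \oc p1 = p2 \oc g /\ d2 \oc a = d1
        & b \oc p2 = p3 /\ d3 \oc b = fmor sus f \oc d2]
}.
Arguments sus {R t}.
Arguments desus {R t}.

(* X[i] is [shift i X]. *)
Definition shift (R : comPzRingType) (C : triangulated R) (i : int) :
    lfunctor C C :=
  match i with
  | Posz n => iter n (lf_comp sus) (lf_id C)
  | Negz n => iter n.+1 (lf_comp desus) (lf_id C)
  end.

(* The class P[i], closed under isomorphisms. *)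
Definition cshift (R : comPzRingType) (C : triangulated R) (P : C -> Prop)
    (i : int) (X : C) : Prop :=
  exists2 Y : C, P Y & isomorphic X (shift C i Y).

Section Functors.
Variables (R : comPzRingType) (C : triangulated R).

Definition cohomological (H : modfun C) : Prop :=
  forall (X Y Z : C) (f : mor X Y) (g : mor Y Z) (h : mor Z (sus X)),
    dist f g h ->
    forall y : H Y, mmor H f y = 0 <-> exists z : H Z, mmor H g z = y.

Definition finite_type (H : modfun C) : Prop :=
  cohomological H /\
  forall M : C, fin_gen (H M) /\
    exists s : seq int, forall i, i \notin s ->
      forall x : H (shift C i M), x = 0.

Definition saturated : Prop :=
  forall H : modfun C, representable H <-> finite_type H.
End Functors.

Record weight_structure (R : comPzRingType) (C : triangulated R) :=
  WeightStructure {
  wle0 : C -> Prop;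
  wge0 : C -> Prop;
  wle_retract : retract_closed wle0;
  wge_retract : retract_closed wge0;
  wle_shift : forall X, wle0 X -> cshift wle0 1 X;
  wge_shift : forall X, cshift wge0 1 X -> wge0 X;
  w_orth : forall X Y, wle0 X -> cshift wge0 1 Y ->
    forall f : mor X Y, f = 0;
  w_dec : forall M : C, exists (L N : C)
    (i : mor L M) (p : mor M N) (d : mor N (sus L)),
    [/\ dist i p d, wle0 L & cshift wge0 1 N]
}.

(* Cohomological convention: C^{t<=0}[1] is contained in C^{t<=0}. *)
Record t_structure (R : comPzRingType) (C : triangulated R) := TStructure {
  tle0 : C -> Prop;
  tge0 : C -> Prop;
  tle_iso : iso_closed tle0;
  tge_iso : iso_closed tge0;
  tle_shift : forall X, cshift tle0 1 X -> tle0 X;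
  tge_shift : forall X, tge0 X -> cshift tge0 1 X;
  t_orth : forall X Y, cshift tle0 1 X -> tge0 Y ->
    forall f : mor X Y, f = 0;
  t_dec : forall M : C, exists (A B : C)
    (i : mor A M) (p : mor M B) (d : mor B (sus A)),
    [/\ dist i p d, tle0 A & cshift tge0 (-1) B]
}.

Section Weights.
Variables (R : comPzRingType) (C : triangulated R) (w : weight_structure C).

Definition wle (i : int) : C -> Prop := cshift (wle0 w) i.
Definition wge (i : int) : C -> Prop := cshift (wge0 w) i.

Definition wheart (X : C) : Prop := wle0 w X /\ wge0 w X.
Definition theart (t : t_structure C) (X : C) : Prop := tle0 t X /\ tge0 t X.

Definition w_bounded : Prop :=
  forall M : C, (exists i, wle i M) /\ (exists i, wge i M).

Definition right_adjacent (t : t_structure C) : Prop :=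
  forall X : C, tle0 t X <-> wge0 w X.

(* w_{<=m}M --> M --> w_{>=m+1}M --> (w_{<=m}M)[1] *)
Record wdec (m : int) (M : C) := WDec {
  wl : C;
  wr : C;
  wi : mor wl M;
  wp : mor M wr;
  wd : mor wr (sus wl);
  wdec_dist : dist wi wp wd;
  wl_le : wle m wl;
  wr_ge : wge (m + 1) wr
}.

(* A choice of w_{<=m}M and w_{>=m+1}M for all m and M. *)
Definition wdecs := forall (m : int) (M : C), wdec m M.
End Weights.
Arguments wl {R C w m M}.
Arguments wr {R C w m M}.
Arguments wi {R C w m M}.
Arguments wp {R C w m M}.
Arguments wd {R C w m M}.

Section CompTheory.
Variables (R : comPzRingType) (C : lincat R).
Implicit Types X Y Z : C.

Lemma comp0m X Y Z (f : mor X Y) : (0 : mor Y Z) \oc f = 0.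
Proof.
have := lcomp_linl 1 0 (0 : mor Y Z) f.
by rewrite !scale1r addr0 => /(congr1 (fun u => u - 0 \oc f));
  rewrite addrK subrr.
Qed.

Lemma compm0 X Y Z (g : mor Y Z) : g \oc (0 : mor X Y) = 0.
Proof.
have := lcomp_linr 1 g (0 : mor X Y) 0.
by rewrite !scale1r addr0 => /(congr1 (fun u => u - g \oc 0));
  rewrite addrK subrr.
Qed.

Lemma compDm X Y Z (g g' : mor Y Z) (f : mor X Y) :
  (g + g') \oc f = g \oc f + g' \oc f.
Proof. by have := lcomp_linl 1 g g' f; rewrite !scale1r. Qed.

Lemma compmD X Y Z (g : mor Y Z) (f f' : mor X Y) :
  g \oc (f + f') = g \oc f + g \oc f'.
Proof. by have := lcomp_linr 1 g f f'; rewrite !scale1r. Qed.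

Lemma compNm X Y Z (g : mor Y Z) (f : mor X Y) : (- g) \oc f = - (g \oc f).
Proof. by apply/eqP; rewrite -addr_eq0 -compDm addNr comp0m. Qed.

Lemma compmN X Y Z (g : mor Y Z) (f : mor X Y) : g \oc (- f) = - (g \oc f).
Proof. by apply/eqP; rewrite -addr_eq0 -compmD addNr compm0. Qed.

Lemma compBm X Y Z (g g' : mor Y Z) (f : mor X Y) :
  (g - g') \oc f = g \oc f - g' \oc f.
Proof. by rewrite compDm compNm. Qed.

Lemma compmB X Y Z (g : mor Y Z) (f f' : mor X Y) :
  g \oc (f - f') = g \oc f - g \oc f'.
Proof. by rewrite compmD compmN. Qed.

Lemma is_isom1 X : is_isom (lid X).
Proof. by exists (lid X); rewrite lcomp1m. Qed.

Lemma is_isomM X Y Z (g : mor Y Z) (f : mor X Y) :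
  is_isom g -> is_isom f -> is_isom (g \oc f).
Proof.
move=> [g' [g'g gg']] [f' [f'f ff']]; exists (f' \oc g'); split.
  by rewrite -lcompA (lcompA g') g'g lcomp1m.
by rewrite -lcompA (lcompA f) ff' lcomp1m.
Qed.

Lemma isomorphic_refl X : isomorphic X X.
Proof. by exists (lid X); apply: is_isom1. Qed.

Lemma isomorphic_sym X Y : isomorphic X Y -> isomorphic Y X.
Proof. by move=> [f [g [gf fg]]]; exists g, f. Qed.

Lemma isomorphic_trans X Y Z : isomorphic X Y ->
  isomorphic Y Z -> isomorphic X Z.
Proof. by move=> [f If] [g Ig]; exists (g \oc f); apply: is_isomM. Qed.

Lemma fmor0 (D : lincat R) (F : lfunctor C D) X Y : fmor F (0 : mor X Y) = 0.
Proof.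
have := fmor_lin F 1 (0 : mor X Y) 0.
by rewrite !scale1r addr0 => /(congr1 (fun u => u - fmor F 0));
  rewrite addrK subrr.
Qed.

Lemma fmorD (D : lincat R) (F : lfunctor C D) X Y (f g : mor X Y) :
  fmor F (f + g) = fmor F f + fmor F g.
Proof. by have := fmor_lin F 1 f g; rewrite !scale1r. Qed.

Lemma fmorN (D : lincat R) (F : lfunctor C D) X Y (f : mor X Y) :
  fmor F (- f) = - fmor F f.
Proof. by apply/eqP; rewrite -addr_eq0 -fmorD addNr fmor0. Qed.

Lemma fmor_is_isom (D : lincat R) (F : lfunctor C D) X Y (f : mor X Y) :
  is_isom f -> is_isom (fmor F f).
Proof.
by move=> [g [gf fg]]; exists (fmor F g); rewrite -!fmorM gf fg !fmor1.
Qed.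

Lemma fmor_iso (D : lincat R) (F : lfunctor C D) X Y :
  isomorphic X Y -> isomorphic (F X) (F Y).
Proof. by move=> [f If]; exists (fmor F f); apply: fmor_is_isom. Qed.

Lemma mmor0 (H : modfun C) X Y (y : H Y) : mmor H (0 : mor X Y) y = 0.
Proof.
have := mmor_lin 1 (0 : mor X Y) 0 y.
by rewrite !scale1r addr0 => /(congr1 (fun u => u - mmor H 0 y));
  rewrite addrK subrr.
Qed.

Lemma equiv_faithful (D : lincat R) (F : lfunctor C D) (G : lfunctor D C) :
  nat_iso (lf_comp G F) (lf_id C) ->
  forall X Y (f g : mor X Y), fmor F f = fmor F g -> f = g.
Proof.
move=> [a [Ia na]] X Y f g e.
have [b [_ ab]] := Ia X.
rewrite -(lcompm1 f) -(lcompm1 g) -ab !lcompA; congr (_ \oc _).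
by rewrite -!(na X Y) /= e.
Qed.
End CompTheory.

Lemma equiv_full (R : comPzRingType) (C D : lincat R) (F : lfunctor C D)
    (G : lfunctor D C) :
  nat_iso (lf_comp G F) (lf_id C) -> nat_iso (lf_comp F G) (lf_id D) ->
  forall (X Y : C) (h : mor (F X) (F Y)), exists f : mor X Y, fmor F f = h.
Proof.
move=> n1 n2 X Y h.
have [a [Ia na]] := n1.
have [b [ba ab]] := Ia X.
have [c [ca ac]] := Ia Y.
exists (a Y \oc fmor G h \oc b).
apply: (equiv_faithful n2).
set f := _ \oc b.
have e : f \oc a X = a Y \oc fmor G h by rewrite /f -lcompA ba lcompm1.
have : a Y \oc fmor G (fmor F f) = a Y \oc fmor G h by rewrite -e -na.
by move=> /(congr1 (fun u => c \oc u)); rewrite !lcompA ca !lcomp1m.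
Qed.

Section TriTheory.
Variables (R : comPzRingType) (C : triangulated R).
Implicit Types X Y Z A B : C.

Lemma sus_faithful X Y (f g : mor X Y) : fmor sus f = fmor sus g -> f = g.
Proof. exact: (equiv_faithful (desus_sus C)). Qed.

Lemma sus_full X Y (h : mor (sus X) (sus Y)) :
  exists f : mor X Y, fmor sus f = h.
Proof. exact: (equiv_full (desus_sus C) (sus_desus C)). Qed.

Lemma sus_iso_inv X Y : isomorphic (sus X) (sus Y) -> isomorphic X Y.
Proof.
move=> [f [g [gf fg]]].
have [f' ef] := sus_full f; have [g' eg] := sus_full g.
by exists f', g'; split; apply: sus_faithful; rewrite fmorM fmor1 ef eg.
Qed.

Lemma sus_desus_iso X : isomorphic (sus (desus X)) X.
Proof. by have [a [Ia _]] := sus_desus C; exists (a X); apply: Ia. Qed.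

Lemma desus_sus_iso X : isomorphic (desus (sus X)) X.
Proof. by have [a [Ia _]] := desus_sus C; exists (a X); apply: Ia. Qed.

Lemma is_zeroP Z : is_zero Z <-> lid Z = 0.
Proof.
split=> [hZ|e X]; first by apply: (proj1 (hZ Z)).
by split=> f; [rewrite -(lcomp1m f) e comp0m|rewrite -(lcompm1 f) e compm0].
Qed.

Lemma is_zero_sus Z : is_zero Z -> is_zero (sus Z).
Proof. by move=> /is_zeroP e; apply/is_zeroP; rewrite -fmor1 e fmor0. Qed.

Section Triangle.
Variables (X Y Z : C) (f : mor X Y) (g : mor Y Z) (h : mor Z (sus X)).
Hypothesis D : dist f g h.

Lemma dist_comp0 : g \oc f = 0.
Proof.
have [O zO] := has_zero C.
have [c [e _]] := dist_mor (dist_id X zO) D (erefl (f \oc lid X)).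
by rewrite -e compm0.
Qed.

Lemma dist_lift A (u : mor A Y) : g \oc u = 0 -> exists v, u = f \oc v.
Proof.
move=> gu.
have [O zO] := has_zero C.
have := (dist_rot _ _ _).1 D.
have := (dist_rot _ _ _).1 (dist_id A zO).
move=> D1 D2.
have e : (0 : mor O Z) \oc (0 : mor A O) = g \oc u by rewrite comp0m gu.
have [c [_ ec]] := dist_mor D1 D2 e.
have [v ev] := sus_full c; exists v; apply: sus_faithful.
move: ec; rewrite fmor1 compmN lcompm1 compNm => /oppr_inj ->.
by rewrite fmorM ev.
Qed.

Lemma dist_colift A (u : mor Y A) : u \oc f = 0 -> exists v, u = v \oc g.
Proof.
move=> uf.
have [O zO] := has_zero C.
have D1 : dist (0 : mor O A) (lid A) (0 : mor A (sus O)).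
  apply/dist_rot; rewrite fmor0 oppr0.
  exact: (dist_id A (is_zero_sus zO)).
have e : u \oc f = (0 : mor O A) \oc (0 : mor X O) by rewrite comp0m uf.
have [c [ec _]] := dist_mor D D1 e.
by exists c; rewrite ec lcomp1m.
Qed.
End Triangle.

Lemma dist_endo X Y Z (f : mor X Y) (g : mor Y Z) (h : mor Z (sus X))
    (e : mor Z Z) :
  dist f g h -> e \oc g = g -> h \oc e = h ->
  e \oc (lid Z - (e - lid Z)) = lid Z /\ (lid Z - (e - lid Z)) \oc e = lid Z.
Proof.
move=> D eg he; pose n := e - lid Z.
have ng : n \oc g = 0 by rewrite compBm eg lcomp1m subrr.
have hn : h \oc n = 0 by rewrite compmB he lcompm1 subrr.
have [k nk] := dist_colift ((dist_rot _ _ _).1 D) ng.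
have nn : n \oc n = 0 by rewrite {1}nk -lcompA hn compm0.
have ee : e = n + lid Z by rewrite subrK.
have en : e \oc n = n by rewrite ee compDm nn add0r lcomp1m.
have ne : n \oc e = n by rewrite ee compmD nn add0r lcompm1.
rewrite -/n compmB compBm lcompm1 lcomp1m en ne.
by rewrite ee (addrC n) addrK.
Qed.

Lemma dist_iso3 X Y Z X' Y' Z' (f : mor X Y) (g : mor Y Z) (h : mor Z (sus X))
    (f' : mor X' Y') (g' : mor Y' Z') (h' : mor Z' (sus X'))
    (a : mor X X') (b : mor Y Y') :
  dist f g h -> dist f' g' h' -> is_isom a -> is_isom b ->
  b \oc f = f' \oc a -> isomorphic Z Z'.
Proof.
move=> D D' [a' [a'a aa']] [b' [b'b bb']] e.
have [c [cg hc]] := dist_mor D D' e.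
have e' : b' \oc f' = f \oc a'.
  rewrite -(lcompm1 (b' \oc f')) -aa' -lcompA (lcompA f') -e.
  by rewrite !lcompA b'b lcomp1m.
have [c' [cg' hc']] := dist_mor D' D e'.
have [q1 _] : (c \oc c') \oc (lid Z' - (c \oc c' - lid Z')) = lid Z' /\
    (lid Z' - (c \oc c' - lid Z')) \oc (c \oc c') = lid Z'.
  apply: (dist_endo D').
    by rewrite -lcompA cg' lcompA cg -lcompA bb' lcompm1.
  by rewrite lcompA -hc -lcompA -hc' lcompA -fmorM aa' fmor1 lcomp1m.
have [_ q2] : (c' \oc c) \oc (lid Z - (c' \oc c - lid Z)) = lid Z /\
    (lid Z - (c' \oc c - lid Z)) \oc (c' \oc c) = lid Z.
  apply: (dist_endo D).
    by rewrite -lcompA cg lcompA cg' -lcompA b'b lcompm1.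
  by rewrite lcompA -hc' -lcompA -hc lcompA -fmorM a'a fmor1 lcomp1m.
set r := (_ - _) in q1; set l := (_ - _) in q2.
exists c, (c' \oc r).
have lr : l \oc c' = c' \oc r.
  rewrite -[l \oc c']lcompm1 -q1 -(lcompA c c' r) !(lcompA _ c).
  by rewrite -(lcompA l c' c) q2 lcomp1m.
by split; [rewrite -lr -lcompA q2 | rewrite lcompA q1].
Qed.

Lemma dist_sus X Y Z (f : mor X Y) (g : mor Y Z) (h : mor Z (sus X)) :
  dist f g h -> dist (- fmor sus f) (- fmor sus g) (- fmor sus h).
Proof. by move=> /dist_rot /dist_rot /dist_rot. Qed.

Lemma shift_sus i X : isomorphic (shift C i (sus X)) (sus (shift C i X)).
Proof.
case: i => n /=.
  elim: n => [|n IH]; [exact: isomorphic_refl|exact: (fmor_iso sus IH)].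
elim: n => [|n IH].
  exact: (isomorphic_trans (desus_sus_iso X)
            (isomorphic_sym (sus_desus_iso X))).
apply: isomorphic_trans (fmor_iso desus IH) _.
exact: (isomorphic_trans (desus_sus_iso _) (isomorphic_sym (sus_desus_iso _))).
Qed.

Lemma shiftS i X : isomorphic (shift C (i + 1) X) (sus (shift C i X)).
Proof.
case: i => n; first by rewrite -PoszD addn1; apply: isomorphic_refl.
case: n => [|n]; first exact: (isomorphic_sym (sus_desus_iso X)).
have -> : Negz n.+1 + 1 = Negz n.
  by rewrite !NegzE -addn1 PoszD opprD addrNK.
exact: (isomorphic_sym (sus_desus_iso _)).
Qed.

Lemma cshift_iso (P : C -> Prop) i X Y :
  isomorphic X Y -> cshift P i Y -> cshift P i X.
Proof. by move=> e [A PA e']; exists A => //; apply: isomorphic_trans e e'. Qed.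

Lemma cshift_sus (P : C -> Prop) i X :
  cshift P (i + 1) (sus X) <-> cshift P i X.
Proof.
split=> -[A PA e]; exists A => //.
  exact: (sus_iso_inv (isomorphic_trans e (shiftS i A))).
exact: (isomorphic_trans (fmor_iso sus e) (isomorphic_sym (shiftS i A))).
Qed.
End TriTheory.

Section WeightTheory.
Variables (R : comPzRingType) (C : triangulated R) (w : weight_structure C).
Implicit Types X Y M : C.

Lemma wle_step m X : wle w m X -> wle w (m + 1) X.
Proof.
move=> [A lA e]; have [B lB eB] := wle_shift lA; exists B => //.
apply: isomorphic_trans e _; apply: isomorphic_trans (fmor_iso _ eB) _.
exact: (isomorphic_trans (shift_sus m B) (isomorphic_sym (shiftS m B))).
Qed.

Lemma wle_mono m n X : m <= n -> wle w m X -> wle w n X.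
Proof.
move=> mn; have -> : n = m + `|n - m|%N :> int.
  by rewrite gez0_abs ?subr_ge0 // subrKC.
elim: `|n - m|%N => [|k IH] wX; first by rewrite addr0.
by rewrite -addn1 PoszD addrA; apply: wle_step; apply: IH.
Qed.

Lemma w_orth_shift m X Y (f : mor (shift C m X) (sus (shift C m Y))) :
  wle0 w X -> wge0 w Y -> f = 0.
Proof.
move=> lX gY.
case: m f => n /=; elim: n => [|n IH] f.
- by apply: (w_orth lX); exists Y => //; apply: isomorphic_refl.
- by have [g <-] := sus_full f; rewrite (IH g) fmor0.
- apply: sus_faithful; rewrite fmor0.
  have [a [a' [a'a aa']]] := sus_desus_iso X.
  have [b [b' [b'b bb']]] := sus_desus_iso Y.
  rewrite -[fmor sus f]lcompm1 -a'a.
  rewrite -[fmor sus f]lcomp1m -[lid (sus (sus _))]fmor1 -b'b fmorM.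
  have -> : fmor sus b' \oc fmor sus b \oc fmor sus f \oc (a' \oc a) =
      fmor sus b' \oc (fmor sus b \oc fmor sus f \oc a') \oc a.
    by rewrite !lcompA.
  have -> : fmor sus b \oc fmor sus f \oc a' = 0.
    by apply: (w_orth lX); exists Y => //; apply: isomorphic_refl.
  by rewrite compm0 comp0m.
- apply: sus_faithful; rewrite fmor0.
  have [a [a' [a'a aa']]] := sus_desus_iso (shift C (Negz n) X).
  have [b [b' [b'b bb']]] := sus_desus_iso (shift C (Negz n) Y).
  rewrite -[fmor sus f]lcompm1 -a'a.
  rewrite -[fmor sus f]lcomp1m -[lid (sus (sus _))]fmor1 -b'b fmorM.
  have -> : fmor sus b' \oc fmor sus b \oc fmor sus f \oc (a' \oc a) =
      fmor sus b' \oc (fmor sus b \oc fmor sus f \oc a') \oc a.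
    by rewrite !lcompA.
  by rewrite (IH (fmor sus b \oc fmor sus f \oc a')) compm0 comp0m.
Qed.

Lemma w_orthW m n X Y (f : mor X Y) :
  m <= n -> wle w m X -> wge w (n + 1) Y -> f = 0.
Proof.
move=> mn /(wle_mono mn) [A lA [a [a' [a'a aa']]]] [B gB eB].
have [b [b' [b'b bb']]] := isomorphic_trans eB (shiftS n B).
rewrite -[f]lcompm1 -a'a -[f]lcomp1m -b'b.
have -> : b' \oc b \oc f \oc (a' \oc a) = b' \oc (b \oc f \oc a') \oc a.
  by rewrite !lcompA.
by rewrite (w_orth_shift (b \oc f \oc a') lA gB) compm0 comp0m.
Qed.

Lemma wdec_up m : (forall M, inhabited (wdec w m M)) ->
  forall M, inhabited (wdec w (m + 1) M).
Proof.
move=> IH M; have [[L N i p d D lL gN]] := IH (desus M).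
have [a Ia] := sus_desus_iso M.
have [a' [a'a aa']] := Ia.
constructor; exists (sus L) (sus N) (a \oc (- fmor sus i)) (- fmor sus p \oc a')
  (- fmor sus d).
- apply: (dist_iso (is_isom1 _) Ia (is_isom1 _)) (dist_sus D).
  + by rewrite lcompm1.
  + by rewrite -lcompA a'a lcomp1m lcompm1.
  + by rewrite fmor1 lcomp1m lcompm1.
- exact/cshift_sus.
- exact/cshift_sus.
Qed.

Lemma wdec_down m : (forall M, inhabited (wdec w (m + 1) M)) ->
  forall M, inhabited (wdec w m M).
Proof.
move=> IH M; have [[L N i p d D lL gN]] := IH (sus M).
have [A lA eA] := lL.
have [a Ia] := isomorphic_trans eA (shiftS m A).
have [a' [a'a aa']] := Ia.
have [u eu] := sus_full (i \oc a').
have [N' [g [h D']]] := dist_cone u.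
constructor; exists (shift C m A) N' u g h => //.
  by exists A => //; apply: isomorphic_refl.
apply/cshift_sus; apply: cshift_iso gN; apply: isomorphic_sym.
have Ia' : is_isom (- a).
  by exists (- a'); rewrite !compNm !compmN !opprK.
apply: (dist_iso3 D (dist_sus D') Ia' (is_isom1 _)).
by rewrite lcomp1m eu compNm compmN opprK -lcompA a'a lcompm1.
Qed.

Lemma wdec_ex m M : inhabited (wdec w m M).
Proof.
have base : forall M, inhabited (wdec w 0 M).
  move=> M'; have [L [N [i [p [d [D lL gN]]]]]] := w_dec w M'.
  constructor; exists L N i p d => //.
  by exists L => //; apply: isomorphic_refl.
case: m => n.
  elim: n M => [//|n IH]; rewrite -addn1 PoszD; exact: wdec_up.
elim: n M => [|n IH] M; first exact: (@wdec_down (Negz 0) base M).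
apply: wdec_down.
have -> // : Negz n.+1 + 1 = Negz n.
by rewrite !NegzE -addn1 PoszD opprD addrNK.
Qed.

Lemma wdecs_ex : inhabited (wdecs w).
Proof.
suff W m M : wdec w m M by constructor.
have e : exists x : wdec w m M, True by have [x] := wdec_ex m M; exists x.
exact: sval (cid e).
Qed.

Section Lift.
Variables (m n : int) (M M' : C) (D : wdec w m M) (D' : wdec w n M').
Variable f : mor M M'.

Lemma wl_lift : m <= n -> exists g : mor (wl D) (wl D'),
  wi D' \oc g = f \oc wi D.
Proof.
move=> mn; have e : wp D' \oc (f \oc wi D) = 0.
  by apply: (w_orthW _ mn (wl_le D) (wr_ge D')).
by have [g ->] := dist_lift (wdec_dist D') e; exists g.
Qed.

Lemma wr_lift : m <= n -> exists g : mor (wr D) (wr D'),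
  g \oc wp D = wp D' \oc f.
Proof.
move=> mn; have e : (wp D' \oc f) \oc wi D = 0.
  by apply: (w_orthW _ mn (wl_le D) (wr_ge D')).
by have [g ->] := dist_colift (wdec_dist D) e; exists g.
Qed.

Let lt_le1 : m < n -> m + 1 <= n.
Proof. by rewrite -lezD1. Qed.

Lemma wl_lift_uniq (g g' : mor (wl D) (wl D')) : m < n ->
  wi D' \oc g = wi D' \oc g' -> g = g'.
Proof.
move=> /lt_le1 mn e; apply/eqP; rewrite -subr_eq0; apply/eqP.
apply: sus_faithful; rewrite fmor0.
have e0 : - fmor sus (wi D') \oc fmor sus (g - g') = 0.
  by rewrite compNm -fmorM compmB e subrr fmor0 oppr0.
have := (dist_rot _ _ _).1 (wdec_dist D').
move=> /dist_rot Dr; have [k ->] := dist_lift Dr e0.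
rewrite (w_orthW k mn _ (wr_ge D')) ?compm0 //.
exact/cshift_sus/wl_le.
Qed.

Lemma wr_lift_uniq (g g' : mor (wr D) (wr D')) : m < n ->
  g \oc wp D = g' \oc wp D -> g = g'.
Proof.
move=> /lt_le1 mn e; apply/eqP; rewrite -subr_eq0; apply/eqP.
have e0 : (g - g') \oc wp D = 0 by rewrite compBm e subrr.
have [k ->] := dist_colift ((dist_rot _ _ _).1 (wdec_dist D)) e0.
rewrite (w_orthW k mn _ (wr_ge D')) ?comp0m //.
exact/cshift_sus/wl_le.
Qed.
End Lift.

(* (c.1, id_M, c.2) is a morphism of triangles *)
Definition wdec_mor m n M (D : wdec w m M) (D' : wdec w n M)
    (c : mor (wl D) (wl D') * mor (wr D) (wr D')) : Prop :=
  [/\ wi D' \oc c.1 = wi D, c.2 \oc wp D = wp D'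
    & fmor sus c.1 \oc wd D = wd D' \oc c.2].

Lemma wdec_mor_ex m n M (D : wdec w m M) (D' : wdec w n M) :
  m < n -> exists c, wdec_mor (D := D) (D' := D') c.
Proof.
move=> mn; have [c ec] := wl_lift D D' (lid M) (ltW mn).
have [|d [e1 e2]] := dist_mor (wdec_dist D) (wdec_dist D')
    (a := c) (b := lid M).
  by rewrite ec.
by exists (c, d); split; rewrite ?ec ?lcomp1m // e1 lcompm1.
Qed.

Lemma wdec_mor_uniq m n M (D : wdec w m M) (D' : wdec w n M) c c' :
  m < n -> wdec_mor (D := D) (D' := D') c -> wdec_mor (D := D) (D' := D') c' ->
  c = c'.
Proof.
case: c c' => [c d] [c' d'] mn [/= i1 p1 _] [/= i2 p2 _]; congr pair.
  by apply: wl_lift_uniq mn _; rewrite i1 i2.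
by apply: wr_lift_uniq mn _; rewrite p1 p2.
Qed.

Section Truncations.
Variable W : wdecs w.

Lemma wstep_lt (m : int) : m < m + 1.
Proof. by rewrite ltzD1. Qed.

Definition wtrans (m : int) M :=
  sval (cid (wdec_mor_ex (W m M) (W (m + 1) M) (wstep_lt m))).

(* w_{<=m}M --> w_{<=m+1}M *)
Definition wl_trans (m : int) M : mor (wl (W m M)) (wl (W (m + 1) M)) :=
  (wtrans m M).1.

(* w_{>=m+1}M --> w_{>=m+2}M *)
Definition wr_trans (m : int) M : mor (wr (W m M)) (wr (W (m + 1) M)) :=
  (wtrans m M).2.

Lemma wtransP m M : wdec_mor (wtrans m M).
Proof. by rewrite /wtrans; case: cid. Qed.

Definition wl_map (m : int) M M' (f : mor M M') :
    mor (wl (W m M)) (wl (W m M')) :=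
  sval (cid (wl_lift (W m M) (W m M') f (lexx m))).

Lemma wl_mapP m M M' (f : mor M M') :
  wi (W m M') \oc wl_map m f = f \oc wi (W m M).
Proof. by rewrite /wl_map; case: cid. Qed.

Definition wr_map (m : int) M M' (f : mor M M') :
    mor (wr (W m M)) (wr (W m M')) :=
  sval (cid (wr_lift (W m M) (W m M') f (lexx m))).

Lemma wr_mapP m M M' (f : mor M M') :
  wr_map m f \oc wp (W m M) = wp (W m M') \oc f.
Proof. by rewrite /wr_map; case: cid. Qed.

Lemma wl_trans_uniq m M M' (g g' : mor (wl (W m M)) (wl (W m M'))) :
  wi (W m M') \oc g = wi (W m M') \oc g' ->
  wl_trans m M' \oc g = wl_trans m M' \oc g'.
Proof.
move=> e; apply: (wl_lift_uniq (wstep_lt m)); rewrite !lcompA.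
by have [-> _ _] := wtransP m M'.
Qed.

Lemma wr_trans_uniq m M M' (g g' : mor (wr (W m M)) (wr (W m M'))) :
  g \oc wp (W m M) = g' \oc wp (W m M) ->
  wr_trans m M' \oc g = wr_trans m M' \oc g'.
Proof.
by move=> e; apply: (wr_lift_uniq (wstep_lt m)); rewrite -!lcompA e.
Qed.

Lemma wl_trans_nat m M M' (f : mor M M') :
  wl_trans m M' \oc wl_map m f = wl_map (m + 1) f \oc wl_trans m M.
Proof.
apply: (wl_lift_uniq (wstep_lt m)); rewrite !lcompA wl_mapP.
have [-> _ _] := wtransP m M'; rewrite wl_mapP -lcompA.
by have [-> _ _] := wtransP m M.
Qed.

Lemma wr_trans_nat m M M' (f : mor M M') :
  wr_trans m M' \oc wr_map m f = wr_map (m + 1) f \oc wr_trans m M.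
Proof.
apply: (wr_lift_uniq (wstep_lt m)); rewrite -!lcompA wr_mapP.
have [_ -> _] := wtransP m M; rewrite wr_mapP lcompA.
by have [_ -> _] := wtransP m M'.
Qed.

Lemma wl_trans1 m M :
  wl_trans m M \oc wl_map m (lid M) = wl_trans m M.
Proof.
by rewrite -[RHS]lcompm1; apply: wl_trans_uniq; rewrite wl_mapP lcomp1m lcompm1.
Qed.

Lemma wl_transM m M M' M'' (g : mor M' M'') (f : mor M M') :
  wl_trans m M'' \oc wl_map m (g \oc f) =
  wl_trans m M'' \oc (wl_map m g \oc wl_map m f).
Proof.
by apply: wl_trans_uniq; rewrite wl_mapP lcompA wl_mapP -!lcompA wl_mapP.
Qed.

Lemma wl_trans_lin m M M' (a : R) (f g : mor M M') :
  wl_trans m M' \oc wl_map m (a *: f + g) =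
  wl_trans m M' \oc (a *: wl_map m f + wl_map m g).
Proof.
by apply: wl_trans_uniq; rewrite wl_mapP lcomp_linr !wl_mapP lcomp_linl.
Qed.

Lemma wr_trans1 m M :
  wr_trans m M \oc wr_map m (lid M) = wr_trans m M.
Proof.
by rewrite -[RHS]lcompm1; apply: wr_trans_uniq; rewrite wr_mapP lcomp1m lcompm1.
Qed.

Lemma wr_transM m M M' M'' (g : mor M' M'') (f : mor M M') :
  wr_trans m M'' \oc wr_map m (g \oc f) =
  wr_trans m M'' \oc (wr_map m g \oc wr_map m f).
Proof.
by apply: wr_trans_uniq; rewrite wr_mapP -lcompA wr_mapP !lcompA wr_mapP.
Qed.

Lemma wr_trans_lin m M M' (a : R) (f g : mor M M') :
  wr_trans m M' \oc wr_map m (a *: f + g) =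
  wr_trans m M' \oc (a *: wr_map m f + wr_map m g).
Proof.
by apply: wr_trans_uniq; rewrite wr_mapP lcomp_linl !wr_mapP lcomp_linr.
Qed.

(* A common frame for the two truncations: M |-> Im (H(B M) -> H(A M)), where
   the maps A M -> A M' lifting f only become functorial after composition
   with c. *)
Section ImageFunctor.
Variables (A B : C -> C) (c : forall M, mor (A M) (B M)).
Variables (a : forall M M', mor M M' -> mor (A M) (A M')).
Variables (b : forall M M', mor M M' -> mor (B M) (B M')).
Hypothesis ab : forall M M' (f : mor M M'), c M' \oc a f = b f \oc c M.
Hypothesis a1 : forall M, c M \oc a (lid M) = c M.
Hypothesis aM : forall M M' M'' (g : mor M' M'') (f : mor M M'),
  c M'' \oc a (g \oc f) = c M'' \oc (a g \oc a f).
Hypothesis alin : forall M M' (r : R) (f g : mor M M'),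
  c M' \oc a (r *: f + g) = c M' \oc (r *: a f + a g).
Variable H : modfun C.

Lemma im_fun_subproof M M' (f : mor M M') (x : H (B M')) :
  exists x', mmor H (c M) x' = mmor H (a f) (mmor H (c M') x).
Proof. by exists (mmor H (b f) x); rewrite -!mmorM ab. Qed.

Program Definition im_fun : modfun C :=
  @ModFun R C (fun M => im (mmor H (c M)))
    (fun M M' f => im_lin (im_fun_subproof f)) _ _ _.
Next Obligation.
by move=> M x; apply: val_inj => /=; case: (imE x) => y <-; rewrite -mmorM a1.
Qed.
Next Obligation.
move=> M M' M'' g f x; apply: val_inj => /=; case: (imE x) => y <-.
by rewrite -!mmorM aM.
Qed.
Next Obligation.
move=> M M' r f g x; apply: val_inj => /=; case: (imE x) => y <-.
by rewrite -!mmorM alin lcomp_linr mmor_lin.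
Qed.
End ImageFunctor.

(* tau^{>=-n}(H)(M) = Im (H(w_{<=n+1}M) --> H(w_{<=n}M)) *)
Definition tau_geN (n : int) (H : modfun C) : modfun C :=
  im_fun (wl_trans_nat n) (wl_trans1 n) (@wl_transM n) (@wl_trans_lin n) H.

(* Im (H(w_{>=m+2}M) --> H(w_{>=m+1}M)) *)
Definition tau_wr (m : int) (H : modfun C) : modfun C :=
  im_fun (wr_trans_nat m) (wr_trans1 m) (@wr_transM m) (@wr_trans_lin m) H.

(* tau^{<=-n}(H)(M) = Im (H(w_{>=n}M) --> H(w_{>=n-1}M)); recall that
   [wr (W m M)] is w_{>=m+1}M. *)
Definition tau_leN (n : int) (H : modfun C) : modfun C := tau_wr (n - 2) H.
End Truncations.
End WeightTheory.

(* Main.v *)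
(** Virtual truncations preserve exactness because, for a triangle
X -> Y -> Z, the cone of w_{<=n}X -> w_{<=n+1}Y is a good enough substitute for
w_{<=n+1}Z, and they preserve finiteness because M[i] has weight > n or <= n
for almost all i. In the saturated case, the object A representing
tau^{<=0}(C(-,M)) comes with a map A -> M whose cone is right orthogonal to
C_{w>=0}, which gives the adjacent t-structure.

An object N of its heart has weight >= 0 and receives no maps from objects of
weight >= 1, so a map w_{>=0} -> N is detected on the heart of w; applied to
the presentation of N by w_{<=0}N this gives full faithfulness. For essential
surjectivity, a functor F on the heart of w is extended to the functor
sending M to the degree 0 cohomology of F on a weight complex of M. It is
cohomological, vanishes on weights >= 1 and <= -1, and takes finitely
generated values if R is noetherian, so it is represented by an object of the
heart of t that restricts to F. *)

From HB Require Import structures.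
Require Import Defs.
From mathcomp Require Import all_boot all_algebra.
From mathcomp Require Import all_order boolp.

Set Implicit Arguments.
Unset Strict Implicit.
Unset Printing Implicit Defensive.

Import Order.TTheory GRing.Theory Num.Theory.
Local Open Scope ring_scope.
#[local] Obligation Tactic := idtac.

Lemma int_far_seq (lo hi : int) :
  exists s : seq int, forall i, i \notin s -> i < lo \/ hi < i.
Proof.
exists [seq lo + k%:Z | k <- iota 0 `|hi - lo|.+1] => i nis.
case: (ltP i lo) => [|lo_i]; [by left | right].
rewrite ltNge; apply/negP => i_hi; case/negP: nis; apply/mapP.
exists `|i - lo|%N; last by rewrite gez0_abs ?subr_ge0 // subrKC.
rewrite mem_iota /= add0n ltnS -lez_nat !gez0_abs ?subr_ge0 ?lerD2r //.
exact: le_trans lo_i i_hi.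
Qed.

Section Modfun.
Variables (R : comPzRingType) (C : lincat R).

Lemma mmorD (H : modfun C) (X Y : C) (f g : mor X Y) (y : H Y) :
  mmor H (f + g) y = mmor H f y + mmor H g y.
Proof. by have := mmor_lin 1 f g y; rewrite !scale1r. Qed.

Lemma mmorN (H : modfun C) (X Y : C) (f : mor X Y) (y : H Y) :
  mmor H (- f) y = - mmor H f y.
Proof. by apply/eqP; rewrite -addr_eq0 -mmorD addNr mmor0. Qed.

Lemma mmorB (H : modfun C) (X Y : C) (f g : mor X Y) (y : H Y) :
  mmor H (f - g) y = mmor H f y - mmor H g y.
Proof. by rewrite mmorD mmorN. Qed.

Lemma nt0 (F G : modfun C) (s : ntrans F G) X : s X 0 = 0.
Proof.
have := nt_lin s 1 (0 : F X) 0.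
by rewrite !scale1r addr0 => /(congr1 (fun u => u - s X 0));
  rewrite addrK subrr.
Qed.

Lemma ntrans_ciso (F G : modfun C) (s : ntrans F G) :
  (forall X, bijective (s X)) -> @ciso (modfun_cat C) F G.
Proof.
move=> bs.
have inv X : {g : G X -> F X | cancel (s X) g /\ cancel g (s X)}.
  by apply: cid; have [g] := bs X; exists g.
have tl (X : C) (a : R) (x y : G X) :
    sval (inv X) (a *: x + y) = a *: sval (inv X) x + sval (inv X) y.
  case: (inv X) => g [sg gs] /=.
  by apply: (can_inj sg); rewrite gs nt_lin !gs.
have tn (X Y : C) (f : mor X Y) (y : G Y) :
    sval (inv X) (mmor G f y) = mmor F f (sval (inv Y) y).
  case: (inv X) (inv Y) => g [sg gs] [h [sh hs]] /=.
  by apply: (can_inj sg); rewrite gs nt_nat hs.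
exists s, (NTrans tl tn); split; apply: ntransP => X x /=.
  by case: (inv X) => g [sg gs] /=.
by case: (inv X) => g [sg gs] /=.
Qed.

Lemma ciso_ntrans (F G : modfun C) :
  @ciso (modfun_cat C) F G -> exists (s : ntrans F G) (t : ntrans G F),
    (forall X, cancel (s X) (t X)) /\ (forall X, cancel (t X) (s X)).
Proof.
move=> [s [t [ts st]]]; exists s, t; split=> X x.
  by have /(congr1 (fun u : ntrans F F => u X x)) := ts.
by have /(congr1 (fun u : ntrans G G => u X x)) := st.
Qed.

Lemma ciso_restr (P : C -> Prop) (F G : modfun C) :
  @ciso (modfun_cat C) F G ->
  @ciso (modfun_cat (fullsub P)) (restr P F) (restr P G).
Proof.
move=> [s [t [ts st]]]; exists (restr_map P s), (restr_map P t).
split; apply: ntransP => X x /=.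
  by have /(congr1 (fun u : ntrans F F => u (sval X) x)) := ts.
by have /(congr1 (fun u : ntrans G G => u (sval X) x)) := st.
Qed.

Lemma ciso_eq0 (F G : modfun C) X :
  @ciso (modfun_cat C) F G -> (forall x : G X, x = 0) -> forall x : F X, x = 0.
Proof.
move=> /ciso_ntrans [s [t [st _]]] G0 x.
by rewrite -(st X x) (G0 (s X x)) nt0.
Qed.

Lemma ciso_trans (D : category) (X Y Z : D) :
  ciso X Y -> ciso Y Z -> ciso X Z.
Proof.
move=> [f [g [gf fg]]] [f' [g' [gf' fg']]].
exists (ccomp f' f), (ccomp g g'); split.
  by rewrite -ccompA (ccompA g') gf' ccomp1m.
by rewrite -ccompA (ccompA f) fg ccomp1m.
Qed.

Lemma ciso_sym (D : category) (X Y : D) : ciso X Y -> ciso Y X.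
Proof. by move=> [f [g [gf fg]]]; exists g, f. Qed.

Lemma representable_yoneda (N : C) : representable (yoneda N).
Proof.
by exists N, (nt_id _), (nt_id _); split; apply: ntransP.
Qed.
End Modfun.

Section Biprod.
Variables (R : comPzRingType) (C : lincat R) (X Y S : C).
Hypothesis bS : is_biprod X Y S.

Lemma biprod_mor0l A :
  (forall f : mor A X, f = 0) -> (forall f : mor A Y, f = 0) ->
  forall f : mor A S, f = 0.
Proof.
have [i1 [i2 [p1 [p2 [_ _ _ _ e]]]]] := bS.
move=> fX fY f; rewrite -(lcomp1m f) -e compDm -!lcompA.
by rewrite (fX (p1 \oc f)) (fY (p2 \oc f)) !compm0 addr0.
Qed.

Lemma biprod_mor0r A :
  (forall f : mor X A, f = 0) -> (forall f : mor Y A, f = 0) ->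
  forall f : mor S A, f = 0.
Proof.
have [i1 [i2 [p1 [p2 [_ _ _ _ e]]]]] := bS.
move=> fX fY f; rewrite -(lcompm1 f) -e compmD !lcompA.
by rewrite (fX (f \oc i1)) (fY (f \oc i2)) !comp0m addr0.
Qed.
End Biprod.

Section Tri.
Variables (R : comPzRingType) (C : triangulated R).
Implicit Types X Y Z A M : C.

Section Triangle.
Variables (X Y Z : C) (f : mor X Y) (g : mor Y Z) (h : mor Z (sus X)).
Hypothesis D : dist f g h.

Lemma dist_lift2 A (u : mor A Z) : h \oc u = 0 -> exists v, u = g \oc v.
Proof. exact: (dist_lift ((dist_rot _ _ _).1 D)). Qed.

Lemma dist_colift2 A (u : mor Z A) : u \oc g = 0 -> exists v, u = v \oc h.
Proof. exact: (dist_colift ((dist_rot _ _ _).1 D)). Qed.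

Lemma dist_comp0_23 : h \oc g = 0.
Proof. exact: (dist_comp0 ((dist_rot _ _ _).1 D)). Qed.


Lemma dist_lift1 A (u : mor A X) : f \oc u = 0 ->
  exists v : mor (sus A) Z, fmor sus u = h \oc v.
Proof.
move=> fu; apply: (dist_lift ((dist_rot _ _ _).1 ((dist_rot _ _ _).1 D))).
by rewrite compNm -fmorM fu fmor0 oppr0.
Qed.

Lemma dist_comp0_31 : fmor sus f \oc h = 0.
Proof.
have := dist_comp0 ((dist_rot _ _ _).1 ((dist_rot _ _ _).1 D)).
by rewrite compNm => /eqP; rewrite oppr_eq0 => /eqP.
Qed.

Lemma dist_colift1 A (u : mor X A) : fmor sus u \oc h = 0 ->
  exists v, u = v \oc f.
Proof.
move=> uh; have D2 := (dist_rot _ _ _).1 ((dist_rot _ _ _).1 D).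
have [v] := dist_colift D2 uh.
have [v' <-] := sus_full v; rewrite compmN -compNm -fmorN -fmorM.
by move=> /sus_faithful e; exists (- v').
Qed.

Lemma dist_split_mono : f = 0 -> exists r, r \oc g = lid Y.
Proof.
move=> f0; have e : lid Y \oc f = 0 by rewrite f0 compm0.
by have [r er] := dist_colift D e; exists r.
Qed.

Lemma dist_split_epi : g = 0 -> exists s, f \oc s = lid Y.
Proof.
move=> g0; have e : g \oc lid Y = 0 by rewrite g0 comp0m.
by have [r er] := dist_lift D e; exists r.
Qed.
End Triangle.

Lemma cshift0 (P : C -> Prop) X : iso_closed P -> cshift P 0 X <-> P X.
Proof.
move=> cP; split=> [[Y PY e]|PX]; first exact: (cP _ _ (isomorphic_sym e)).
by exists X => //; apply: isomorphic_refl.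
Qed.

Lemma cshift_shift (P : C -> Prop) a i X :
  cshift P (a + i) (shift C i X) <-> cshift P a X.
Proof.
have step j : cshift P (a + (j + 1)) (shift C (j + 1) X) <->
    cshift P (a + j) (shift C j X).
  rewrite addrA; split.
    move=> h; apply/cshift_sus.
    exact: (cshift_iso (isomorphic_sym (shiftS j X)) h).
  by move=> /cshift_sus; apply: cshift_iso; apply: shiftS.
elim/int_rect: i => [|n IH|n IH]; first by rewrite addr0.
  by rewrite -addn1 PoszD; apply: iff_trans IH; apply: step.
apply: iff_trans IH; apply: iff_sym.
have -> : - n%:Z = - n.+1%:Z + 1 by rewrite -addn1 PoszD opprD addrNK.
exact: step.
Qed.

Lemma cshift_desus (P : C -> Prop) i X :
  cshift P (i - 1) (desus X) <-> cshift P i X.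
Proof. exact: (@cshift_shift P i (-1) X). Qed.

Lemma retract_iso_closed (P : C -> Prop) : retract_closed P -> iso_closed P.
Proof. by move=> cP X Y [f [g [gf fg]]]; apply: cP fg. Qed.

Lemma cshift_retract (P : C -> Prop) m : retract_closed P ->
  retract_closed (cshift P m).
Proof.
move=> cP X Y i p pi.
have E Z : cshift P m Z <-> P (shift C (- m) Z).
  rewrite -(cshift_shift P m (- m)) subrr.
  exact: (cshift0 _ (retract_iso_closed cP)).
move=> /E PX; apply/E.
apply: (cP _ _ (fmor (shift C (- m)) i) (fmor (shift C (- m)) p)) PX.
by rewrite -fmorM pi fmor1.
Qed.
End Tri.

Section Weight.
Variables (R : comPzRingType) (C : triangulated R) (w : weight_structure C).
Implicit Types X Y Z A M : C.

Lemma wle_0 X : wle w 0 X <-> wle0 w X.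
Proof. exact: (cshift0 _ (retract_iso_closed (@wle_retract _ _ w))). Qed.

Lemma wge_0 X : wge w 0 X <-> wge0 w X.
Proof. exact: (cshift0 _ (retract_iso_closed (@wge_retract _ _ w))). Qed.

Lemma wgeP m n X : n + 1 = m ->
  wge w m X <-> forall A, wle w n A -> forall f : mor A X, f = 0.
Proof.
move=> <-; split=> [gX A lA f|h]; first exact: (w_orthW _ (lexx n) lA gX).
have [[L N i p d D lL gN]] := wdec_ex w n X.
have [r rp] := dist_split_mono D (h _ lL i).
exact: (cshift_retract (@wge_retract _ _ w) rp gN).
Qed.

Lemma wleP m n X : m + 1 = n ->
  wle w m X <-> forall A, wge w n A -> forall f : mor X A, f = 0.
Proof.
move=> <-; split=> [lX A gA f|h]; first exact: (w_orthW _ (lexx m) lX gA).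
have [[L N i p d D lL gN]] := wdec_ex w m X.
have [s si] := dist_split_epi D (h _ gN p).
exact: (cshift_retract (@wle_retract _ _ w) si lL).
Qed.

Lemma wge_mono m n X : m <= n -> wge w n X -> wge w m X.
Proof.
move=> mn gX; apply/(wgeP _ (subrK 1 m)) => A lA f.
apply: (w_orthW f _ lA (n := n - 1)); first by rewrite lerD2r.
by rewrite subrK.
Qed.

Lemma wheart_wl0 X (D : wdec w 0 X) : wge0 w X -> wheart w (wl D).
Proof.
move=> /wge_0 gX; split; first exact/wle_0/wl_le.
apply/wge_0/(@wgeP 0 (-1)) => // A lA f; apply: sus_faithful; rewrite fmor0.
have [|v ->] := dist_lift1 (wdec_dist D) (u := f).
  exact: (w_orthW _ (lexx (-1)) lA gX).
rewrite (w_orthW v (lexx 0) _ (wr_ge D)) ?compm0 //.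
exact/(cshift_sus _ (-1)).
Qed.
End Weight.

(** * Virtual truncations *)

Section FinGenImage.
Variables (R : comPzRingType) (U V : lmodType R) (f : {linear U -> V}).

Lemma fin_gen_im : fin_gen U -> fin_gen (im f).
Proof.
move=> [n [e he]]; exists n, (fun i => Defs.Im (im_in f (e i))) => y.
have [x fx] := imE y; have [a ax] := he x; exists a; apply: val_inj.
rewrite -fx ax linear_sum raddf_sum; apply: eq_bigr => i _.
by rewrite !linearZ.
Qed.

Lemma im_eq0 : (forall x, f x = 0) -> forall y : im f, y = 0.
Proof. by move=> f0 y; apply: val_inj => /=; have [x <-] := imE y. Qed.
End FinGenImage.

Section ImFun.
Variables (R : comPzRingType) (C : triangulated R).
Variables (A B : C -> C) (c : forall M, mor (A M) (B M)).
Variables (a : forall M M', mor M M' -> mor (A M) (A M')).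
Variables (b : forall M M', mor M M' -> mor (B M) (B M')).
Hypothesis ab : forall M M' (f : mor M M'), c M' \oc a f = b f \oc c M.
Hypothesis a1 : forall M, c M \oc a (lid M) = c M.
Hypothesis aM : forall M M' M'' (g : mor M' M'') (f : mor M M'),
  c M'' \oc a (g \oc f) = c M'' \oc (a g \oc a f).
Hypothesis alin : forall M M' (r : R) (f g : mor M M'),
  c M' \oc a (r *: f + g) = c M' \oc (r *: a f + a g).
Variable H : modfun C.
Let T := im_fun ab a1 aM alin H.

Lemma im_fun_cohomological : cohomological H ->
  (forall X Y Z (f : mor X Y) (g : mor Y Z) (h : mor Z (sus X)), dist f g h ->
   exists (E : C) (l : mor (B Y) E) (d : mor E (sus (A X))) (k : mor (B Z) E),
     dist (b f \oc c X) l d /\ k \oc b g \oc c Y = l \oc c Y) ->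
  cohomological T.
Proof.
move=> cH hE X Y Z f g h D y; split=> [|[z <-]]; last first.
  by rewrite -mmorM (dist_comp0 D) mmor0.
have [E [l [d [k [DE ek]]]]] := hE _ _ _ _ _ _ D.
case: (imE y) => x ex /(congr1 val) /=; rewrite -ex -mmorM ab => e.
have [z ez] := (cH _ _ _ _ _ _ DE x).1 e.
exists (Defs.Im (im_in _ (mmor H k z))); apply: val_inj; rewrite /= -ex -ez.
by rewrite -!mmorM ab lcompA ek.
Qed.
End ImFun.

Section Trunc.
Variables (R : comPzRingType) (C : triangulated R) (w : weight_structure C).
Variable W : wdecs w.
Implicit Types (X Y Z M : C) (H : modfun C).

Lemma wi_trans m M : wi (W (m + 1) M) \oc wl_trans W m M = wi (W m M).
Proof. by have [] := wtransP W m M. Qed.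

Lemma wp_trans m M : wr_trans W m M \oc wp (W m M) = wp (W (m + 1) M).
Proof. by have [] := wtransP W m M. Qed.

Section Cone.
Variables (X Y Z : C) (f : mor X Y) (g : mor Y Z) (h : mor Z (sus X)).
Hypothesis D : dist f g h.
Variable m : int.

(* The cone of w_{<=m}X -> w_{<=m+1}Y plays the role of w_{<=m+1}Z. *)
Lemma wl_cone : exists (E : C) (l : mor (wl (W (m + 1) Y)) E)
    (d : mor E (sus (wl (W m X)))) (k : mor (wl (W (m + 1) Z)) E),
  dist (wl_map W (m + 1) f \oc wl_trans W m X) l d /\
  k \oc wl_map W (m + 1) g \oc wl_trans W m Y = l \oc wl_trans W m Y.
Proof.
set u := wl_map _ _ f \oc _.
have [E [l [d DE]]] := dist_cone u.
have [F [p [q DF]]] := dist_cone (f \oc wi (W m X)).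
have eu : wi (W (m + 1) Y) \oc u = f \oc wi (W m X).
  by rewrite lcompA wl_mapP -lcompA wi_trans.
have DF' : dist (wi (W (m + 1) Y) \oc u) p q by rewrite eu.
have [a [b [Dab [ab1 ab2] [ab3 ab4]]]] := dist_octahedron
  (wdec_dist (W m X)) DF D.
have [a' [b' [Dab' [ab1' ab2'] [ab3' ab4']]]] := dist_octahedron
  DE DF' (wdec_dist (W (m + 1) Y)).
have orthX A (v : mor A (sus (wr (W m X)))) : wle w (m + 1) A -> v = 0.
  move=> lA; apply: (w_orthW _ (lexx _) lA).
  by apply/cshift_sus/wr_ge.
have orthY A (v : mor A (wr (W (m + 1) Y))) : wle w (m + 1) A -> v = 0.
  by move=> lA; apply: (w_orthW _ (lexx _) lA); apply: wr_ge.
have lZ := wl_le (W (m + 1) Z).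
have [k1 ek1] : exists k1, wi (W (m + 1) Z) = b \oc k1.
  by apply: (dist_lift2 Dab); apply: orthX.
have [k ek] : exists k, k1 = a' \oc k.
  by apply: (dist_lift Dab'); apply: orthY.
exists E, l, d, k; split=> //.
have lY := wl_le (W m Y).
apply/eqP; rewrite -subr_eq0; apply/eqP; set v := (X in X = 0).
have e1 : b \oc (a' \oc l) = g \oc wi (W (m + 1) Y).
  by rewrite ab1' lcompA ab3.
have e2 : b \oc (a' \oc k) = wi (W (m + 1) Z) by rewrite -ek ek1.
have v0 : b \oc (a' \oc v) = 0.
  apply/eqP; rewrite /v !compmB subr_eq0 !lcompA -!(lcompA b a') e1 e2 wl_mapP.
  by [].
have v1 : a' \oc v = 0.
  have [v1 ->] := dist_lift Dab v0.
  by rewrite (w_orthW v1 (lexx m) lY (wr_ge _)) compm0.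
apply: sus_faithful; rewrite fmor0.
have [v2 ->] := dist_lift1 Dab' v1.
by rewrite (orthY _ v2) ?compm0 //; apply/cshift_sus.
Qed.

Lemma wr_cone : exists (E : C) (l : mor (wr (W (m + 1) Y)) E)
    (d : mor E (sus (wr (W m X)))) (k : mor (wr (W (m + 1) Z)) E),
  dist (wr_map W (m + 1) f \oc wr_trans W m X) l d /\
  k \oc wr_map W (m + 1) g \oc wr_trans W m Y = l \oc wr_trans W m Y.
Proof.
set u := wr_map _ _ f \oc _.
have [E [l [d DE]]] := dist_cone u.
have eu : u \oc wp (W m X) = wp (W (m + 1) Y) \oc f.
  by rewrite -lcompA wp_trans wr_mapP.
have orthE A (v : mor A E) : wle w (m + 1) A -> v = 0.
  move=> lA; have dv : d \oc v = 0.
    apply: (w_orthW _ (lexx _) lA).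
    by apply/cshift_sus/wr_ge.
  have [v' ->] := dist_lift2 DE dv.
  by rewrite (w_orthW v' (lexx _) lA (wr_ge _)) compm0.
have [k0 ek0] : exists k0, l \oc wp (W (m + 1) Y) = k0 \oc g.
  apply: (dist_colift D).
  by rewrite -lcompA -eu lcompA (dist_comp0 DE) comp0m.
have [k ek] : exists k, k0 = k \oc wp (W (m + 1) Z).
  by apply: (dist_colift (wdec_dist _)); apply: orthE; apply: wl_le.
exists E, l, d, k; split=> //.
apply/eqP; rewrite -subr_eq0; apply/eqP; set v := (X in X = 0).
have v0 : v \oc wp (W m Y) = 0.
  rewrite /v compBm -!lcompA !wp_trans wr_mapP.
  by rewrite lcompA -ek ek0 subrr.
have [v1 ->] := dist_colift2 (wdec_dist (W m Y)) v0.
by rewrite (orthE _ v1) ?comp0m //; apply/cshift_sus/wl_le.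
Qed.
End Cone.

Lemma tau_geN_cohomological n H :
  cohomological H -> cohomological (tau_geN W n H).
Proof.
move=> cH; apply: im_fun_cohomological => // X Y Z f g h D.
exact: wl_cone D n.
Qed.

Lemma tau_wr_cohomological m H :
  cohomological H -> cohomological (tau_wr W m H).
Proof.
move=> cH; apply: im_fun_cohomological => // X Y Z f g h D.
exact: wr_cone D m.
Qed.

Lemma tau_geN_eq0_ge n H M :
  wge w (n + 1) M -> forall x : tau_geN W n H M, x = 0.
Proof.
move=> gM; apply: im_eq0 => y.
suff -> : wl_trans W n M = 0 by rewrite mmor0.
apply: (wl_lift_uniq (wstep_lt n)).
by rewrite wi_trans compm0; apply: (w_orthW _ (lexx n) (wl_le _) gM).
Qed.

Lemma tau_geN_eq0_le n H M : wle w n M -> (forall x : H M, x = 0) ->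
  forall x : tau_geN W n H M, x = 0.
Proof.
move=> lM HM0; apply: im_eq0 => y.
have [s es] : exists s, wi (W n M) \oc s = lid M.
  apply: (dist_split_epi (wdec_dist _)).
  exact: (w_orthW _ (lexx n) lM (wr_ge _)).
have -> : wl_trans W n M = wl_trans W n M \oc (s \oc wi (W n M)).
  rewrite -[LHS]lcompm1; apply: wl_trans_uniq.
  by rewrite lcompA es lcomp1m lcompm1.
by rewrite lcompA mmorM (HM0 (mmor H (_ \oc s) y)) linear0.
Qed.

Lemma tau_wr_eq0_le m H M :
  wle w (m + 1) M -> forall x : tau_wr W m H M, x = 0.
Proof.
move=> lM; apply: im_eq0 => y.
suff -> : wr_trans W m M = 0 by rewrite mmor0.
apply: (wr_lift_uniq (wstep_lt m)).
by rewrite wp_trans comp0m; apply: (w_orthW _ (lexx _) lM (wr_ge _)).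
Qed.

Lemma wp_split_mono m M : wge w (m + 1) M ->
  exists r, r \oc wp (W m M) = lid M.
Proof.
move=> gM; apply: (dist_split_mono (wdec_dist _)).
exact: (w_orthW _ (lexx m) (wl_le _) gM).
Qed.

Lemma wr_trans_retract m M r : r \oc wp (W m M) = lid M ->
  wr_trans W m M = wr_trans W m M \oc (wp (W m M) \oc r).
Proof.
move=> er; rewrite -[LHS]lcompm1; apply: wr_trans_uniq.
by rewrite lcomp1m -lcompA er lcompm1.
Qed.

Lemma tau_wr_eq0_ge m H M : wge w (m + 1) M -> (forall x : H M, x = 0) ->
  forall x : tau_wr W m H M, x = 0.
Proof.
move=> /wp_split_mono [r er] HM0; apply: im_eq0 => y.
rewrite (wr_trans_retract er) lcompA mmorM.
by rewrite (HM0 (mmor H (_ \oc _) y)) linear0.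
Qed.

Section FiniteType.
Hypothesis w_bdd : w_bounded w.

Lemma shift_far m n M : exists s : seq int, forall i, i \notin s ->
  wge w m (shift C i M) \/ wle w n (shift C i M).
Proof.
have [[b lM] [a gM]] := w_bdd M.
have [s hs] := int_far_seq (n - b) (m - a).
exists s => i /hs [/ltW|/ltW] hi; [right | left].
  by apply: wle_mono ((cshift_shift _ b i M).2 lM); rewrite -lerBrDl.
by apply: wge_mono ((cshift_shift _ a i M).2 gM); rewrite -lerBlDl.
Qed.

Lemma tau_finite_type n H (T : modfun C) :
  finite_type H -> cohomological T -> (forall M, fin_gen (T M)) ->
  (forall M, wge w (n + 1) M -> (forall x : H M, x = 0) ->
     forall x : T M, x = 0) ->
  (forall M, wle w n M -> (forall x : H M, x = 0) -> forall x : T M, x = 0) ->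
  finite_type T.
Proof.
move=> fH cT fT gT lT; split=> // M; split=> //.
have [_ [s hs]] := fH.2 M.
have [s' hs'] := shift_far (n + 1) n M.
exists (s ++ s') => i; rewrite mem_cat negb_or => /andP [/hs h0 /hs' [g|l]].
  exact: gT.
exact: lT.
Qed.

Lemma tau_geN_finite_type n H : finite_type H -> finite_type (tau_geN W n H).
Proof.
move=> fH; apply: (tau_finite_type (n := n) fH).
- exact: tau_geN_cohomological fH.1.
- by move=> M; apply: fin_gen_im (fH.2 _).1.
- by move=> M gM _; apply: tau_geN_eq0_ge.
- by move=> M; apply: tau_geN_eq0_le.
Qed.

Lemma tau_wr_finite_type m H : finite_type H -> finite_type (tau_wr W m H).
Proof.
move=> fH; apply: (tau_finite_type (n := m) fH).
- exact: tau_wr_cohomological fH.1.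
- by move=> M; apply: fin_gen_im (fH.2 _).1.
- by move=> M; apply: tau_wr_eq0_ge.
- by move=> M lM _; apply: tau_wr_eq0_le; apply: wle_mono lM; rewrite lerDl.
Qed.
End FiniteType.
End Trunc.

Section Adjacent.
Variables (R : comPzRingType) (C : triangulated R) (w : weight_structure C).
Hypotheses (w_bdd : w_bounded w) (sC : saturated C).
Variable W : wdecs w.
Implicit Types (X Y Z M N A : C).

Definition adj_tge0 N :=
  forall X, cshift (wge0 w) 1 X -> forall f : mor X N, f = 0.

Lemma adj_tge0_iso : iso_closed adj_tge0.
Proof.
move=> X Y [u [v [_ uv]]] hX A gA f.
by rewrite -(lcomp1m f) -uv -lcompA (hX _ gA (v \oc f)) compm0.
Qed.

Lemma adj_tge0_sus B :
  (forall X, wge0 w X -> forall f : mor X B, f = 0) -> adj_tge0 (sus B).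
Proof.
move=> hB X [Y gY [u [v [vu uv]]]] f.
have [g eg] := sus_full (f \oc v : mor (sus Y) (sus B)).
by rewrite -(lcompm1 f) -vu lcompA -eg (hB _ gY g) fmor0 comp0m.
Qed.

Lemma adj_tge0_shift N : adj_tge0 N -> cshift adj_tge0 1 N.
Proof.
move=> hN; exists (desus N); last exact: (isomorphic_sym (sus_desus_iso N)).
move=> X gX f; apply: sus_faithful; rewrite fmor0.
have [u [v [vu uv]]] := sus_desus_iso N.
rewrite -(lcomp1m (fmor sus f)) -vu -lcompA.
rewrite (hN _ _ (u \oc fmor sus f)) ?compm0 //.
exists X; last exact: isomorphic_refl.
exact: wge_shift gX.
Qed.

Program Definition tau_wr_incl m (H : modfun C) : ntrans (tau_wr W m H) H :=
  @NTrans R C (tau_wr W m H) H (fun M x => mmor H (wp (W m M)) (val x)) _ _.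
Next Obligation. by move=> m H M a x y; apply: linearP. Qed.
Next Obligation.
by move=> m H X Y f y /=; rewrite -!mmorM wr_mapP.
Qed.

Lemma tau_wr_incl_inj m (H : modfun C) M : wge w (m + 1) M ->
  forall x, tau_wr_incl m H M x = 0 -> x = 0.
Proof.
move=> /(wp_split_mono W) [r er] x /=; have [y ey] := imE x.
move=> e; apply: val_inj => /=; rewrite -ey.
by rewrite (wr_trans_retract er) lcompA mmorM mmorM ey e linear0.
Qed.

Lemma tau_wr_incl_surj m (H : modfun C) M : wge w (m + 1 + 1) M ->
  forall y, exists x, tau_wr_incl m H M x = y.
Proof.
move=> /(wp_split_mono W) [r er] y.
exists (Defs.Im (im_in (mmor H (wr_trans W m M)) (mmor H r y))) => /=.
by rewrite -!mmorM wp_trans er mmor1.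
Qed.

(* A represents tau^{<=0}(C(-,M)); on X of weight >= 0, composition with
   A -> M is surjective on Hom(X,-) and injective on Hom(X[-1],-). *)
Lemma adj_dec M :
  exists (A B : C) (i : mor A M) (p : mor M B) (d : mor B (sus A)),
  [/\ dist i p d, wge0 w A & cshift adj_tge0 (-1) B].
Proof.
pose T := tau_wr W (-2) (yoneda M).
have [A /ciso_ntrans [s [t [ts1 st1]]]] : representable T.
  apply/sC/(tau_wr_finite_type W w_bdd); apply/sC; exact: representable_yoneda.
pose i : mor A M := tau_wr_incl (-2) (yoneda M) A (s A (lid A)).
have iE X (u : mor X A) : i \oc u = tau_wr_incl (-2) (yoneda M) X (s X u).
  have := nt_nat (nt_comp (tau_wr_incl (-2) (yoneda M)) s) u (lid A).
  by rewrite /= /precomp lcomp1m => ->.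
have gA : wge0 w A.
  apply/wge_0/(@wgeP _ _ _ _ (-1)) => // X lX f.
  by rewrite -(ts1 X f) (tau_wr_eq0_le (m := -2) lX (s X f)) nt0.
have i_inj X (u : mor X A) : wge w (-1) X -> i \oc u = 0 -> u = 0.
  move=> gX; rewrite iE => e.
  have su : s X u = 0 by apply: (tau_wr_incl_inj (m := -2) gX).
  by rewrite -(ts1 X u) su nt0.
have i_surj X (v : mor X M) : wge w 0 X -> exists u, i \oc u = v.
  move=> gX; have [x <-] := tau_wr_incl_surj (m := -2) (H := yoneda M) gX v.
  by exists (t X x); rewrite iE st1.
have [B [p [d D]]] := dist_cone i.
exists A, B, i, p, d; split=> //.
exists (sus B); last exact: (isomorphic_sym (desus_sus_iso B)).
apply: adj_tge0_sus => X gX f.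
have [a [a' [a'a aa']]] := sus_desus_iso X.
have [u eu] := sus_full (d \oc f \oc a).
have u0 : u = 0.
  apply: i_inj; first exact/(cshift_desus (wge0 w) 0)/wge_0.
  apply: sus_faithful; rewrite fmorM eu fmor0.
  by rewrite !lcompA (dist_comp0_31 D) !comp0m.
have df : d \oc f = 0.
  by rewrite -(lcompm1 f) -aa' !lcompA -eu u0 fmor0 comp0m.
have [v ->] := dist_lift2 D df.
have [v' <-] := i_surj _ v ((wge_0 _ _).2 gX).
by rewrite lcompA (dist_comp0 D) comp0m.
Qed.

Lemma adjacent_t_structure : exists t : t_structure C, right_adjacent w t.
Proof.
pose t := @TStructure R C (wge0 w) adj_tge0
  (retract_iso_closed (@wge_retract _ _ w)) adj_tge0_iso (@wge_shift _ _ w)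
  adj_tge0_shift (fun X Y gX hY f => hY X gX f) adj_dec.
by exists t.
Qed.
End Adjacent.

(** * Full faithfulness *)

Section TStructure.
Variables (R : comPzRingType) (C : triangulated R) (t : t_structure C).

Lemma tge0_orth (N : C) :
  (forall X, cshift (tle0 t) 1 X -> forall f : mor X N, f = 0) -> tge0 t N.
Proof.
move=> hN; have [A [B [i [p [d [D tA tB]]]]]] := t_dec t (desus N).
have gA : cshift (tle0 t) 1 (sus A).
  by apply/(cshift_sus _ 0)/(cshift0 _ (@tle_iso _ _ t)).
have gB : tge0 t (sus B).
  by apply/(cshift0 _ (@tge_iso _ _ t))/(cshift_sus _ (-1)).
have [a [a' [a'a aa']]] := sus_desus_iso N.
have i0 : i = 0.
  apply: sus_faithful; rewrite fmor0 -[fmor sus i]lcomp1m -a'a -lcompA.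
  by rewrite (hN _ gA (a \oc _)) compm0.
have d0 : d = 0.
  have e : - fmor sus i \oc lid (sus A) = 0 by rewrite i0 fmor0 oppr0 comp0m.
  have [s es] := dist_lift2 ((dist_rot _ _ _).1 D) e.
  have s0 : s = 0.
    apply: sus_faithful; rewrite fmor0; apply: t_orth gB _.
    by apply/(cshift_sus _ 0)/(cshift0 _ (@tle_iso _ _ t)); apply: tle_shift.
  by rewrite -[d]lcomp1m es s0 compm0 comp0m.
have [r er] := dist_split_epi ((dist_rot _ _ _).1 D) d0.
have rp : r \oc p = lid (desus N).
  apply/eqP; rewrite -subr_eq0; apply/eqP.
  have e : p \oc (r \oc p - lid _) = 0.
    by rewrite compmB lcompA er lcomp1m lcompm1 subrr.
  by have [v ->] := dist_lift D e; rewrite i0 comp0m.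
have e : isomorphic (sus B) (sus (desus N)) by apply: fmor_iso; exists r, p.
exact: (tge_iso (isomorphic_trans e (sus_desus_iso N)) gB).
Qed.
End TStructure.

Section FullyFaithful.
Variables (R : comPzRingType) (C : triangulated R) (w : weight_structure C).
Variables (t : t_structure C) (wt : right_adjacent w t).
Implicit Types (X Y Z M N A : C).

Lemma theart_wge0 N : theart t N -> wge0 w N.
Proof. by move=> [/wt]. Qed.

Lemma theart_orth N X (f : mor X N) : theart t N -> wge w 1 X -> f = 0.
Proof.
move=> [_ tN] [Y gY e]; apply: (t_orth _ tN).
by exists Y => //; apply/wt.
Qed.

Lemma theart_detect N X (f : mor X N) : theart t N -> wge0 w X ->
  (forall Q, wheart w Q -> forall u : mor Q X, f \oc u = 0) -> f = 0.
Proof.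
move=> tN gX hf; have [D] := wdec_ex w 0 X.
have [v ->] := dist_colift (wdec_dist D) (hf _ (wheart_wl0 D gX) (wi D)).
by rewrite (theart_orth v tN (wr_ge D)) comp0m.
Qed.

Lemma restr_yoneda_ff
    (fg : forall N X : C, theart t N -> wheart w X -> fin_gen (mor X N)) :
  fully_faithful (restr_yoneda fg).
Proof.
move=> [N tN] [N' tN']; set Q := wheart w.
have gN := theart_wge0 tN.
pose F (f : mor N N') := restr_map Q (yoneda_map f).
have injF : injective F.
  move=> f f' e; apply/eqP; rewrite -subr_eq0; apply/eqP.
  apply: theart_detect => // X hX u; rewrite compBm.
  have := congr1
    (fun s : ntrans (restr Q (yoneda N)) _ => s (exist _ X hX) u) e.
  by move=> /= ->; rewrite subrr.
have surF s : exists f, F f = s.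
  have [D] := wdec_ex w 0 N.
  pose P : fullsub Q := exist _ (wl D) (wheart_wl0 D gN).
  pose x : mor (wl D) N' := s P (wi D).
  have [|f ef] := dist_colift1 (wdec_dist D) (u := x).
    have [a [a' [a'a aa']]] := sus_desus_iso (wr D).
    have [y ey] := sus_full (fmor sus x \oc wd D \oc a).
    suff y0 : y = 0.
      by rewrite -[LHS]lcompm1 -aa' lcompA -ey y0 fmor0 comp0m.
    apply: theart_detect => // [|X hX u].
      exact/wge_0/(cshift_desus _ 1)/wr_ge.
    have [k ek] := sus_full (wd D \oc a \oc fmor sus u).
    have wk : wi D \oc k = 0.
      apply: sus_faithful; rewrite fmorM ek fmor0.
      by rewrite !lcompA (dist_comp0_31 (wdec_dist D)) !comp0m.
    apply: sus_faithful; rewrite fmorM ey fmor0 -!lcompA.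
    rewrite [wd D \oc _]lcompA -ek -fmorM.
    have <- : s (exist _ X hX) (wi D \oc k) = x \oc k.
      exact: (nt_nat s (X := exist _ X hX) (Y := P) k (wi D)).
    by rewrite wk nt0 fmor0.
  exists f; apply: ntransP => X u /=.
  have [v ->] : exists v, u = wi D \oc v.
    apply: (dist_lift (wdec_dist D)).
    exact: (w_orthW _ (lexx 0) ((wle_0 _ _).2 (svalP X).1) (wr_ge D)).
  by rewrite lcompA -ef; apply/esym/(nt_nat s (X := X) (Y := P) v (wi D)).
exists (fun s => sval (cid (surF s))) => [f|s] /=.
  by apply: injF; case: cid.
by case: cid.
Qed.
End FullyFaithful.

(** * Subquotients of modules *)

Record submod (R : comPzRingType) (V : lmodType R) := Submod {
  smem :> V -> Prop;
  smem0 : smem 0;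
  smemP : forall a u v, smem u -> smem v -> smem (a *: u + v)
}.

Section Submod.
Variables (R : comPzRingType) (V : lmodType R) (S : submod V).

Lemma smemD u v : S u -> S v -> S (u + v).
Proof. by move=> Su Sv; have := smemP 1 Su Sv; rewrite scale1r. Qed.

Lemma smemZ a u : S u -> S (a *: u).
Proof. by move=> Su; have := smemP a Su (smem0 S); rewrite addr0. Qed.

Lemma smemN u : S u -> S (- u).
Proof. by rewrite -scaleN1r; apply: smemZ. Qed.

Lemma smemB u v : S u -> S v -> S (u - v).
Proof. by move=> Su Sv; apply/smemD/smemN. Qed.
End Submod.

Section Span.
Variables (R : comPzRingType) (V : lmodType R).

Fixpoint span (s : seq V) (v : V) : Prop :=
  if s is e :: s' then exists a u, span s' u /\ v = a *: e + u else v = 0.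

Lemma span0 s : span s 0.
Proof. by elim: s => //= e s IH; exists 0, 0; rewrite scale0r addr0. Qed.

Lemma spanP s a u v : span s u -> span s v -> span s (a *: u + v).
Proof.
elim: s u v => [|e s IH] u v /=; first by move=> -> ->; rewrite scaler0 addr0.
move=> [b [u' [su ->]]] [c [v' [sv ->]]].
exists (a * b + c), (a *: u' + v'); split; first exact: IH.
by rewrite scalerDr scalerA scalerDl addrACA.
Qed.

Definition span_submod s : submod V := Submod (span0 s) (@spanP s).

Lemma span_sum I (r : seq I) (a : I -> R) (e : I -> V) :
  span [seq e i | i <- r] (\sum_(i <- r) a i *: e i).
Proof.
elim: r => [|i r IH] /=; first by rewrite big_nil.
by rewrite big_cons; exists (a i), (\sum_(j <- r) a j *: e j).
Qed.

Lemma span_cat s t u v : span s u -> span t v -> span (s ++ t) (u + v).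
Proof.
elim: s u => [|e s IH] u /=; first by move=> ->; rewrite add0r.
by move=> [a [u' [su ->]]] tv; exists a, (u' + v); rewrite addrA; split; auto.
Qed.

Lemma fin_genP : fin_gen V <-> exists s, forall v, span s v.
Proof.
split=> [[n [e he]]|[s hs]].
  exists [seq e i | i <- index_enum 'I_n] => v.
  by have [a ->] := he v; apply: span_sum.
exists (size s), (fun i => s`_i) => v.
suff [a ->] : exists a : nat -> R, v = \sum_(i < size s) a i *: s`_i.
  by exists (fun i => a i).
elim: s v {hs}(hs v) => [|e s IH] v /=.
  by exists (fun=> 0); rewrite big_ord0.
move=> [a [u [/IH [b ->] ->]]]; exists (fun i => if i is j.+1 then b j else a).
by rewrite big_ord_recl.
Qed.
End Span.

Lemma span_map (R : comPzRingType) (V V' : lmodType R) (S : submod V)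
    (f : V -> V') :
  f 0 = 0 -> (forall a u v, S u -> S v -> f (a *: u + v) = a *: f u + f v) ->
  forall s v, (forall x, x \in s -> S x) -> span s v ->
  S v /\ span (map f s) (f v).
Proof.
move=> f0 fl; elim=> [|e s IH] v sS /=.
  by move=> ->; split=> //; apply: smem0.
move=> [a [u [su ->]]].
have [|Su su'] := IH u _ su.
  by move=> x xs; apply: sS; rewrite in_cons xs orbT.
have Se : S e by apply: sS; apply: mem_head.
split; first exact: smemP.
by exists a, (f u); rewrite fl.
Qed.

Lemma noetherian_span (R : comPzRingType) (V : lmodType R) :
  noetherian R -> forall (s : seq V) (S : submod V),
  exists t : seq V, (forall x, x \in t -> S x) /\
    forall v, S v -> span s v -> span t v.
Proof.
move=> nR; elim=> [|e s IH] S; first by exists [::].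
pose I r := exists z u, [/\ S z, span s u & z = r *: e + u].
have II : is_ideal I.
  split.
  - exists 0, 0; rewrite scale0r addr0.
    by split=> //; [apply: smem0 | apply: span0].
  - move=> x y [z [u [Sz su ez]]] [z' [u' [Sz' su' ez']]].
    exists (z + z'), (u + u'); split; first exact: smemD.
      exact: (@smemD _ _ (span_submod s)).
    by rewrite ez ez' scalerDl addrACA.
  - move=> a x [z [u [Sz su ez]]]; exists (a *: z), (a *: u).
    split; [exact: smemZ | exact: (@smemZ _ _ (span_submod s)) |].
    by rewrite ez scalerDr scalerA.
have [n [r [Ir hr]]] := nR I II.
have /choice [z hz] : forall i, exists z, S z /\ span s (z - r i *: e).
  move=> i; have [z [u [Sz su ez]]] := Ir i; exists z; split=> //.
  by rewrite ez addrC addKr.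
pose S' := @Submod R V (fun v => S v /\ span s v) (conj (smem0 S) (span0 s))
  (fun a u v hu hv => conj (smemP a hu.1 hv.1) (spanP a hu.2 hv.2)).
have [t [tS ht]] := IH S'.
exists ([seq z i | i <- index_enum 'I_n] ++ t); split.
  move=> x; rewrite mem_cat => /orP [/mapP [i _ ->]|/tS []//].
  exact: (hz i).1.
move=> v Sv [a [u [su ev]]].
have [|b eb] := hr a; first by exists v, u.
rewrite -(subrKC (\sum_i b i *: z i) v).
have Sz : S (\sum_i b i *: z i).
  apply: (big_ind S) => [|x y|i _]; [exact: smem0 | exact: smemD |].
  by apply: smemZ; apply: (hz i).1.
have St : S (v - \sum_i b i *: z i) by apply: smemB.
apply: span_cat; first exact: span_sum.
suff sv : span s (v - \sum_i b i *: z i) by apply: ht.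
have -> : v - \sum_i b i *: z i = u - \sum_i b i *: (z i - r i *: e).
  rewrite ev eb; under [X in u - X]eq_bigr => i _ do rewrite scalerBr scalerA.
  by rewrite sumrB scaler_suml opprB addrA [u + _]addrC.
apply: (@smemB _ _ (span_submod s)) => //=.
apply: (big_ind (span s)) => [|x y|i _]; first exact: span0.
  exact: (@smemD _ _ (span_submod s)).
by apply: (@smemZ _ _ (span_submod s)); apply: (hz i).2.
Qed.

Section Subquotient.
Variables (R : comPzRingType) (V : lmodType R) (Z B : submod V).

Definition in_coset (v : V) : pred V := fun x => `[< Z x /\ B (x - v) >].

Definition canon (v : V) : V := choose (in_coset v) v.

Lemma canonP v : Z v -> Z (canon v) /\ B (canon v - v).
Proof.
move=> Zv; have : in_coset v v.
  by apply/asboolP; rewrite subrr; split=> //; apply: smem0.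
by move=> /(@chooseP V _ _) /asboolP.
Qed.

Lemma canon_eq u v : Z u -> Z v -> (canon u = canon v) <-> B (u - v).
Proof.
move=> Zu Zv; have [[_ Bu] [_ Bv]] := (canonP Zu, canonP Zv).
split=> [e|Buv].
  by have := smemB Bv Bu; rewrite e opprB [RHS in B RHS]addrC addrA subrK.
have e : in_coset u =1 in_coset v.
  move=> x; apply/asbool_equiv_eq; split=> -[Zx Bx]; split=> //.
    by have := smemD Bx Buv; rewrite addrA subrK.
  by have := smemB Bx Buv; rewrite opprB addrA subrK.
rewrite /canon (eq_choose e); apply: choose_id; apply/asboolP; split=> //.
by rewrite subrr; apply: smem0.
Qed.

(* The subquotient Z / (B :&: Z), carried by a system of representatives. *)
Record subquo := Subquo {
  sqval : V;
  _ : `[< Z sqval /\ canon sqval = sqval >]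
}.
HB.instance Definition _ := [isSub for sqval].
HB.instance Definition _ := [Choice of subquo by <:].

Definition repr (v : V) : V := canon (if `[< Z v >] then v else 0).

Lemma repr_subproof v : `[< Z (repr v) /\ canon (repr v) = repr v >].
Proof.
apply/asboolP; rewrite /repr; set u := if _ then _ else _.
have Zu : Z u by rewrite /u; case: asboolP => // _; apply: smem0.
have [Zx Bx] := canonP Zu; split=> //.
exact/(canon_eq Zx Zu).
Qed.

(* Outside of Z, the junk value cls 0. *)
Definition cls v : subquo := Subquo (repr_subproof v).

Lemma cls_eq u v : Z u -> Z v -> cls u = cls v <-> B (u - v).
Proof.
move=> Zu Zv; rewrite -(canon_eq Zu Zv); split=> [/(congr1 val) /=|e].
  by rewrite /repr !asboolT.
by apply: val_inj; rewrite /= /repr !asboolT.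
Qed.

Lemma sqvalP x : Z (sqval x).
Proof. by case: x => x /= /asboolP []. Qed.

Lemma sqvalK : cancel sqval cls.
Proof.
case=> x hx; apply: val_inj => /=; case/asboolP: hx => Zx.
by rewrite /repr asboolT.
Qed.

Lemma cls_val v : Z v -> B (sqval (cls v) - v).
Proof. by move=> Zv; apply/cls_eq => //; [apply: sqvalP | apply: sqvalK]. Qed.

Let add x y := cls (sqval x + sqval y).
Let opp x := cls (- sqval x).
Let scale a x := cls (a *: sqval x).

Let clsD u v : Z u -> Z v -> add (cls u) (cls v) = cls (u + v).
Proof.
move=> Zu Zv; apply/cls_eq; try by apply: smemD => //; apply: sqvalP.
by rewrite opprD addrACA; apply: smemD; apply: cls_val.
Qed.

Let clsZ a u : Z u -> scale a (cls u) = cls (a *: u).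
Proof.
move=> Zu; apply/cls_eq; try by apply: smemZ => //; apply: sqvalP.
by rewrite -scalerBr; apply: smemZ; apply: cls_val.
Qed.

Let clsN u : Z u -> opp (cls u) = cls (- u).
Proof.
move=> Zu; apply/cls_eq; try by apply: smemN => //; apply: sqvalP.
by rewrite -opprD; apply: smemN; apply: cls_val.
Qed.

Let clsW (P : subquo -> Prop) : (forall v, Z v -> P (cls v)) -> forall x, P x.
Proof. by move=> h x; rewrite -(sqvalK x); apply: h; apply: sqvalP. Qed.

Let addA : associative add.
Proof.
apply: clsW => u Zu; apply: clsW => v Zv; apply: clsW => x Zx.
by rewrite !clsD ?addrA //; apply: smemD.
Qed.

Let addC : commutative add.
Proof. by move=> x y; rewrite /add addrC. Qed.

Let add0 : left_id (cls 0) add.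
Proof. by apply: clsW => u Zu; rewrite clsD ?add0r //; apply: smem0. Qed.

Let addN : left_inverse (cls 0) opp add.
Proof.
by apply: clsW => u Zu; rewrite clsN // clsD ?addNr //; apply: smemN.
Qed.

HB.instance Definition _ := GRing.isZmodule.Build subquo addA addC add0 addN.

Let scaleA a b x : scale a (scale b x) = scale (a * b) x.
Proof.
by move: x; apply: clsW => u Zu; rewrite !clsZ ?scalerA //; apply: smemZ.
Qed.

Let scale1 : left_id 1 scale.
Proof. by apply: clsW => u Zu; rewrite clsZ ?scale1r. Qed.

Let scaleDr : right_distributive scale +%R.
Proof.
move=> a; apply: clsW => u Zu; apply: clsW => v Zv.
rewrite [X in scale a X](clsD Zu Zv) !clsZ //; last exact: smemD.
by rewrite [RHS](clsD (smemZ a Zu) (smemZ a Zv)) scalerDr.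
Qed.

Let scaleDl x : {morph scale^~ x : a b / a + b}.
Proof.
move: x; apply: clsW => u Zu a b; rewrite !clsZ //.
by rewrite [RHS](clsD (smemZ a Zu) (smemZ b Zu)) scalerDl.
Qed.

HB.instance Definition _ := GRing.Zmodule_isLmodule.Build R subquo
  scaleA scale1 scaleDr scaleDl.

Lemma cls_lin a u v : Z u -> Z v -> cls (a *: u + v) = a *: cls u + cls v.
Proof.
move=> Zu Zv; apply/esym; rewrite [a *: _](clsZ a Zu).
exact: clsD (smemZ a Zu) Zv.
Qed.

Lemma cls0 : cls 0 = 0. Proof. by []. Qed.

Lemma cls_eq0 u : Z u -> cls u = 0 <-> B u.
Proof. by move=> Zu; rewrite -cls0 (cls_eq Zu (smem0 Z)) subr0. Qed.

Lemma fin_gen_subquo : noetherian R -> fin_gen V -> fin_gen subquo.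
Proof.
move=> nR /fin_genP [s hs]; apply/fin_genP.
have [t [tZ ht]] := noetherian_span nR s Z.
exists (map cls t) => x; rewrite -(sqvalK x).
apply: (span_map (S := Z) cls0 cls_lin tZ (ht _ (sqvalP x) (hs _))).2.
Qed.
End Subquotient.

Section SubquotientMap.
Variables (R : comPzRingType) (V V' : lmodType R).
Variables (Z B : submod V) (Z' B' : submod V') (f : {linear V -> V'}).
Hypothesis fZ : forall v, Z v -> Z' (f v).
Hypothesis fB : forall v, Z v -> B v -> B' (f v).

Definition subquo_map (x : subquo Z B) : subquo Z' B' :=
  cls Z' B' (f (sqval x)).

Lemma subquo_mapE v : Z v -> subquo_map (cls Z B v) = cls Z' B' (f v).
Proof.
move=> Zv; have Zx := sqvalP (cls Z B v).
apply/cls_eq; [exact: fZ | exact: fZ |].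
by rewrite -linearB; apply: fB; [apply: smemB | apply: cls_val].
Qed.

Lemma subquo_map_linear : linear subquo_map.
Proof.
move=> a x y; rewrite -(sqvalK x) -(sqvalK y).
have [Zx Zy] := (sqvalP x, sqvalP y).
rewrite -cls_lin // !subquo_mapE //; last exact: smemP.
by rewrite linearP cls_lin //; apply: fZ.
Qed.

HB.instance Definition _ := GRing.isLinear.Build R (subquo Z B) (subquo Z' B') _
  subquo_map subquo_map_linear.

Definition subquo_lin : {linear subquo Z B -> subquo Z' B'} := subquo_map.
End SubquotientMap.

(** * Extension of functors from the heart *)

Lemma wheart_biprod (R : comPzRingType) (C : triangulated R)
    (w : weight_structure C) (X Y S : C) :
  is_biprod X Y S -> wheart w X -> wheart w Y -> wheart w S.
Proof.
move=> bS [/wle_0 lX /wge_0 gX] [/wle_0 lY /wge_0 gY]; split.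
  apply/wle_0/(@wleP _ _ _ 0 1) => // A gA.
  apply: (biprod_mor0r bS) => f; first exact: (w_orthW f (lexx 0) lX gA).
  exact: (w_orthW f (lexx 0) lY gA).
apply/wge_0/(@wgeP _ _ _ 0 (-1)) => // A lA.
apply: (biprod_mor0l bS) => f; first exact: (w_orthW f (lexx (-1)) lA gX).
exact: (w_orthW f (lexx (-1)) lA gY).
Qed.

Section Extension.
Variables (R : comPzRingType) (C : triangulated R) (w : weight_structure C).
Variable W : wdecs w.
Let Hw := fullsub (wheart w).
Variable F : modfun Hw.
Implicit Types (M N A : C) (Q : Hw).

Definition pull Q Q' (u : mor (sval Q) (sval Q')) : {linear F Q' -> F Q} :=
  @mmor R Hw F Q Q' u.

Lemma pull1 Q x : pull (lid (sval Q)) x = x.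
Proof. exact: (@mmor1 R Hw F Q x). Qed.

Lemma pullM Q Q' Q'' (v : mor (sval Q') (sval Q''))
    (u : mor (sval Q) (sval Q')) x :
  pull (v \oc u) x = pull u (pull v x).
Proof. exact: (@mmorM R Hw F Q Q' Q'' v u x). Qed.

Lemma pull_lin Q Q' a (u v : mor (sval Q) (sval Q')) x :
  pull (a *: u + v) x = a *: pull u x + pull v x.
Proof. exact: (@mmor_lin R Hw F Q Q' a u v x). Qed.

Lemma pull0 Q Q' x : pull (0 : mor (sval Q) (sval Q')) x = 0.
Proof. exact: (@mmor0 R Hw F Q Q' x). Qed.

Lemma pullD Q Q' (u v : mor (sval Q) (sval Q')) x :
  pull (u + v) x = pull u x + pull v x.
Proof. exact: (@mmorD R Hw F Q Q' u v x). Qed.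

Lemma pullB Q Q' (u v : mor (sval Q) (sval Q')) x :
  pull (u - v) x = pull u x - pull v x.
Proof. exact: (@mmorB R Hw F Q Q' u v x). Qed.

(* hX M is w_{>=0}M; hP M is w_{<=0}w_{>=0}M, the degree 0 term of a weight
   complex of M. *)
Definition hX M : C := wr (W (-1) M).
Definition hp M : mor M (hX M) := wp (W (-1) M).

Lemma hX_ge M : wge0 w (hX M).
Proof. exact/wge_0/(wr_ge (W (-1) M)). Qed.

Definition hP M : Hw := exist _ _ (wheart_wl0 (W 0 (hX M)) (hX_ge M)).
Definition hi M : mor (sval (hP M)) (hX M) := wi (W 0 (hX M)).

Lemma heart_le Q : wle w 0 (sval Q).
Proof. exact/wle_0/(svalP Q).1. Qed.

Lemma hi_lift M A (u : mor A (hX M)) : wle w 0 A -> exists v, u = hi M \oc v.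
Proof.
move=> lA; apply: (dist_lift (wdec_dist (W 0 (hX M)))).
exact: (w_orthW _ (lexx 0) lA (wr_ge _)).
Qed.

(* A is (w_{<=-1}M)[1]. *)
Lemma hp_colift M Y (u : mor (hX M) Y) : u \oc hp M = 0 ->
  exists A (d : mor (hX M) A) (v : mor A Y),
    [/\ wle w 0 A, d \oc hp M = 0 & u = v \oc d].
Proof.
move=> /(dist_colift2 (wdec_dist (W (-1) M))) [v ->].
exists (sus (wl (W (-1) M))), (wd (W (-1) M)), v; split=> //.
  by apply/(cshift_sus _ (-1))/wl_le.
exact: dist_comp0_23 (wdec_dist _).
Qed.

(* The differentials of the weight complex are replaced by all maps between
   hP M and the heart that vanish towards hX M, resp. extend to hX M and
   vanish on M. *)
Definition is_cocycle M (a : F (hP M)) : Prop :=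
  forall Q (u : mor (sval Q) (sval (hP M))), hi M \oc u = 0 -> pull u a = 0.

Lemma is_cocycle0 M : is_cocycle (0 : F (hP M)).
Proof. by move=> Q u _; rewrite linear0. Qed.

Lemma is_cocycleP M r (a b : F (hP M)) :
  is_cocycle a -> is_cocycle b -> is_cocycle (r *: a + b).
Proof. by move=> ha hb Q u e; rewrite linearP ha ?hb // scaler0 addr0. Qed.

Definition cocycle M : submod (F (hP M)) :=
  Submod (@is_cocycle0 M) (@is_cocycleP M).

Definition is_cobound M (a : F (hP M)) : Prop :=
  exists Q (q : mor (hX M) (sval Q)) (b : F Q),
    q \oc hp M = 0 /\ a = pull (q \oc hi M) b.

Lemma is_cobound0 M : is_cobound (0 : F (hP M)).
Proof. by exists (hP M), 0, 0; rewrite comp0m linear0. Qed.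

Lemma is_coboundP M r (a b : F (hP M)) :
  is_cobound a -> is_cobound b -> is_cobound (r *: a + b).
Proof.
move=> [Q [q [x [qp ->]]]] [Q' [q' [x' [qp' ->]]]].
have [S bS] := has_biprod (sval Q) (sval Q').
pose QS : Hw := exist _ S (wheart_biprod bS (svalP Q) (svalP Q')).
have [i1 [i2 [p1 [p2 [p1i1 p2i2 p1i2 p2i1 _]]]]] := bS.
exists QS, (i1 \oc q + i2 \oc q'),
  (r *: pull (Q := QS) p1 x + pull (Q := QS) p2 x').
split; first by rewrite compDm -!lcompA qp qp' !compm0 addr0.
rewrite linearP -!pullM !lcompA !compmD !lcompA.
by rewrite p1i1 p1i2 p2i1 p2i2 !lcomp1m !comp0m addr0 add0r.
Qed.

Definition cobound M : submod (F (hP M)) :=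
  Submod (@is_cobound0 M) (@is_coboundP M).

Definition covers M N (f : mor M N) (g : mor (sval (hP M)) (sval (hP N))) :=
  exists x : mor (hX M) (hX N),
    x \oc hp M = hp N \oc f /\ hi N \oc g = x \oc hi M.

Lemma covers_ex M N (f : mor M N) : exists g, covers f g.
Proof.
have [x ex] := wr_lift (W (-1) M) (W (-1) N) f (lexx (-1)).
by have [g eg] := hi_lift (x \oc hi M) (heart_le (hP M)); exists g, x.
Qed.

Lemma covers1 M : covers (lid M) (lid _).
Proof. by exists (lid _); rewrite !lcomp1m !lcompm1. Qed.

Lemma coversM L M N (f : mor L M) (f' : mor M N) g g' :
  covers f g -> covers f' g' -> covers (f' \oc f) (g' \oc g).
Proof.
move=> [x [xp ix]] [x' [xp' ix']]; exists (x' \oc x); split.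
  by rewrite -lcompA xp lcompA xp' lcompA.
by rewrite lcompA ix' -lcompA ix lcompA.
Qed.

Lemma covers_lin M N a (f f' : mor M N) g g' :
  covers f g -> covers f' g' -> covers (a *: f + f') (a *: g + g').
Proof.
move=> [x [xp ix]] [x' [xp' ix']]; exists (a *: x + x').
by rewrite !lcomp_linl !lcomp_linr xp xp' ix ix'.
Qed.

Lemma coversB M N (f f' : mor M N) g g' :
  covers f g -> covers f' g' -> covers (f - f') (g - g').
Proof.
move=> h h'; rewrite addrC [g - g']addrC -[- f']scaleN1r -[- g']scaleN1r.
exact: covers_lin.
Qed.

Lemma covers_cocycle M N (f : mor M N) g a :
  covers f g -> cocycle N a -> cocycle M (pull g a).
Proof.
move=> [x [_ ix]] ha Q u iu; rewrite -pullM; apply: ha.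
by rewrite lcompA ix -lcompA iu compm0.
Qed.

Lemma covers_cobound M N (f : mor M N) g a :
  covers f g -> cobound N a -> cobound M (pull g a).
Proof.
move=> [x [xp ix]] [Q [q [b [qp ->]]]]; exists Q, (q \oc x), b; split.
  by rewrite -lcompA xp lcompA qp comp0m.
by rewrite -pullM -!lcompA ix.
Qed.

Lemma covers0_cobound M N g a :
  covers (0 : mor M N) g -> cocycle N a -> cobound M (pull g a).
Proof.
move=> [x [xp ix]] ha; rewrite compm0 in xp.
have [A [d [v [lA dp ex]]]] := hp_colift xp.
have [v' ev] := hi_lift v lA.
exists (hP N), (v' \oc d), a; split; first by rewrite -lcompA dp compm0.
apply/eqP; rewrite -subr_eq0 -pullB; apply/eqP/ha.
by rewrite compmB ix !lcompA -ev -ex subrr.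
Qed.

Lemma covers_cls M N (f : mor M N) g g' a : covers f g -> covers f g' ->
  cocycle N a ->
  cls (cocycle M) (cobound M) (pull g a) = cls _ (cobound M) (pull g' a).
Proof.
move=> hg hg' ha; apply/cls_eq.
- exact: covers_cocycle hg ha.
- exact: covers_cocycle hg' ha.
rewrite -pullB; apply: covers0_cobound ha.
by rewrite -(subrr f); apply: coversB.
Qed.

Section Map.
Variables (M N : C) (f : mor M N).
Definition cover := sval (cid (covers_ex f)).
Lemma coverP : covers f cover. Proof. by rewrite /cover; case: cid. Qed.
Definition ext_map := subquo_lin (fun a => @covers_cocycle _ _ _ _ a coverP)
  (fun a _ => @covers_cobound _ _ _ _ a coverP).

Lemma ext_mapE g a : covers f g -> cocycle N a ->
  ext_map (cls _ _ a) = cls _ _ (pull g a).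
Proof.
move=> hg ha; apply: etrans (covers_cls coverP hg ha).
apply: subquo_mapE ha => b; first exact: covers_cocycle coverP.
by move=> _; apply: covers_cobound coverP.
Qed.
End Map.

Program Definition ext : modfun C :=
  @ModFun R C (fun M => subquo (cocycle M) (cobound M)) ext_map _ _ _.
Next Obligation.
move=> M x; rewrite -(sqvalK x) (ext_mapE (covers1 M)) ?pull1 //.
exact: sqvalP.
Qed.
Next Obligation.
move=> L M N g f x; rewrite -(sqvalK x); have Zx := sqvalP x.
rewrite (ext_mapE (coversM (coverP f) (coverP g)) Zx) (ext_mapE (coverP g) Zx).
rewrite (ext_mapE (coverP f)) ?pullM //.
by apply: covers_cocycle Zx; apply: coverP.
Qed.
Next Obligation.
move=> M N a f g x; rewrite -(sqvalK x); have Zx := sqvalP x.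
rewrite (ext_mapE (covers_lin a (coverP f) (coverP g)) Zx).
rewrite (ext_mapE (coverP f) Zx) (ext_mapE (coverP g) Zx) pull_lin cls_lin //.
  by apply: covers_cocycle Zx; apply: coverP.
by apply: covers_cocycle Zx; apply: coverP.
Qed.

Lemma ext_eq0 M : covers (0 : mor M M) (lid _) -> forall x : ext M, x = 0.
Proof.
move=> h x; rewrite -(sqvalK x); have Zx := sqvalP x.
by apply/cls_eq0 => //; have := covers0_cobound h Zx; rewrite pull1.
Qed.

Lemma ext_eq0_ge M : wge w 1 M -> forall x : ext M, x = 0.
Proof.
move=> gM; apply: ext_eq0.
have [|r rp] := wp_split_mono W (m := -1) (M := M).
  exact: wge_mono gM.
exists (lid _ - hp M \oc r); rewrite !compBm compm0 lcompm1 !lcomp1m.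
split; first by rewrite -lcompA rp lcompm1 subrr.
rewrite -lcompA [r \oc hi M](w_orthW _ (lexx 0) (heart_le _) gM) compm0.
by rewrite subr0.
Qed.

Lemma ext_eq0_le M : wle w (-1) M -> forall x : ext M, x = 0.
Proof.
move=> lM; apply: ext_eq0; exists (lid _); rewrite lcompm1 !lcomp1m compm0.
by split=> //; apply: (w_orthW _ (lexx (-1)) lM (wr_ge _)).
Qed.

(* If the restriction of a to X is the coboundary of b along q : hX X -> Q, the
   cone E of hX X -> hX Y (+) Q receives a map from hX Z, and (a, -b)
   extends to E because it vanishes on hX X. *)
Lemma ext_cohomological : cohomological ext.
Proof.
move=> X Y Z f g h D y; split=> [|[z <-]]; last first.
  by rewrite -mmorM (dist_comp0 D) mmor0.
rewrite -(sqvalK y); set a := sqval y; have Za : cocycle Y a := sqvalP y.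
have [phi [x [xp ix]]] := covers_ex f.
have cphi : covers f phi by exists x.
rewrite [mmor _ _ _](ext_mapE cphi Za).
move=> /(cls_eq0 _ (covers_cocycle cphi Za)) [Q [q [b [qp eb]]]].
have [S bS] := has_biprod (hX Y) (sval Q).
have [j1 [j2 [p1 [p2 [p1j1 p2j2 p1j2 p2j1 e12]]]]] := bS.
pose s := j1 \oc x + j2 \oc q.
have p1s : p1 \oc s = x.
  by rewrite compmD !lcompA p1j1 p1j2 lcomp1m comp0m addr0.
have p2s : p2 \oc s = q.
  by rewrite compmD !lcompA p2j1 p2j2 lcomp1m comp0m add0r.
have [E [e [d DE]]] := dist_cone s.
have lift_e A (u : mor A E) : wle w 0 A -> exists v, u = e \oc v.
  move=> lA; apply: (dist_lift2 DE); apply: (w_orthW _ (lexx 0) lA).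
  exact/(cshift_sus _ 0)/wge_0/hX_ge.
have key Q' (v : mor (sval Q') S) (u : mor (sval Q') (sval (hP Y))) :
    hi Y \oc u = p1 \oc v -> e \oc v = 0 -> pull u a = pull (p2 \oc v) b.
  move=> iu ev; have [v1 ev1] := dist_lift DE ev.
  have [v2 ev2] := hi_lift v1 (heart_le Q').
  have -> : pull u a = pull (phi \oc v2) a.
    apply/eqP; rewrite -subr_eq0 -pullB; apply/eqP/Za.
    by rewrite compmB iu ev1 lcompA p1s lcompA ix -lcompA -ev2 subrr.
  by rewrite pullM eb -pullM ev1 lcompA p2s -lcompA ev2.
have [m em] : exists m, e \oc j1 \oc hp Y = m \oc g.
  apply: (dist_colift D); rewrite -lcompA -xp.
  have -> : e \oc j1 \oc (x \oc hp X) = e \oc (s - j2 \oc q) \oc hp X.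
    by rewrite addrK !lcompA.
  by rewrite compmB (dist_comp0 DE) sub0r compNm -!lcompA qp !compm0 oppr0.
have [k ek] : exists k, m = k \oc hp Z.
  apply: (dist_colift (wdec_dist (W (-1) Z))).
  have gE : wge w 0 E.
    apply/(@wgeP _ _ _ 0 (-1)) => // A lA u.
    have [v ->] := lift_e _ u (wle_mono (m := -1) (n := 0) isT lA).
    have -> : v = 0.
      move: v; apply: (biprod_mor0l bS) => v.
        exact: (w_orthW _ (lexx (-1)) lA ((wge_0 _ _).2 (hX_ge Y))).
      exact: (w_orthW _ (lexx (-1)) lA ((wge_0 _ _).2 (svalP Q).2)).
    by rewrite compm0.
  exact: (w_orthW _ (lexx (-1)) (wl_le _) gE).
have [t et] := lift_e _ (k \oc hi Z) (heart_le (hP Z)).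
have [tau etau] := hi_lift (p1 \oc t) (heart_le (hP Z)).
pose c := pull tau a - pull (p2 \oc t) b.
have Zc : cocycle Z c.
  move=> Q' u iu; rewrite linearB -!pullM.
  apply/eqP; rewrite subr_eq0; apply/eqP.
  rewrite -lcompA; apply: key; first by rewrite !lcompA -etau.
  by rewrite lcompA -et -lcompA iu compm0.
exists (cls _ _ c).
have [psi [z [zp iz]]] := covers_ex g.
have cpsi : covers g psi by exists z.
rewrite [mmor _ _ _](ext_mapE cpsi Zc).
apply/cls_eq => //; first exact: covers_cocycle cpsi Zc.
have [|A [dA [v [lA dp ev]]]] := hp_colift (M := Y) (u := k \oc z - e \oc j1).
  by rewrite compBm -lcompA zp em ek lcompA subrr.
have [v1 ev1] := lift_e _ v lA.
have [th eth] := hi_lift (p1 \oc v1) lA.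
have -> : pull psi c - a =
    pull (th \oc dA \oc hi Y) a - pull (p2 \oc v1 \oc dA \oc hi Y) b.
  pose v0 := t \oc psi - j1 \oc hi Y - v1 \oc (dA \oc hi Y).
  pose u0 := tau \oc psi - lid _ - th \oc (dA \oc hi Y).
  have hv : hi Y \oc u0 = p1 \oc v0.
    rewrite !compmB lcompm1 !lcompA p1j1 lcomp1m -etau -eth.
    by [].
  have ev0 : e \oc v0 = 0.
    rewrite !compmB !lcompA -ev1 -et -ev compBm -!lcompA iz.
    by rewrite subrr.
  have := key (hP Y) v0 u0 hv ev0.
  rewrite /u0 !pullB pull1 => e0.
  have -> : pull psi c = pull (tau \oc psi) a - pull (p2 \oc t \oc psi) b.
    by rewrite linearB -!pullM.
  have -> : pull (p2 \oc t \oc psi) b =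
      pull (p2 \oc v0) b + pull (p2 \oc v1 \oc dA \oc hi Y) b.
    rewrite -pullD -!lcompA -compmD /v0 subrK compmB !lcompA p2j1 comp0m.
    by rewrite subr0.
  rewrite -e0 -(lcompA th) !opprD !opprK !addrA subrr add0r.
  by rewrite -(addrA a) (addrC a) addrK.
apply: smemB.
  by exists (hP Y), (th \oc dA), a; rewrite -lcompA dp compm0.
by exists Q, (p2 \oc v1 \oc dA), b; rewrite -!lcompA dp !compm0.
Qed.

Lemma ext_finite_type : w_bounded w -> noetherian R ->
  (forall Q, fin_gen (F Q)) -> finite_type ext.
Proof.
move=> bw nR fF; split=> [|M]; first exact: ext_cohomological.
split; first exact: fin_gen_subquo.
have [s hs] := shift_far bw 1 (-1) M.
by exists s => i /hs [/ext_eq0_ge|/ext_eq0_le].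
Qed.

Section Heart.
Variable M : Hw.

Lemma hp_retract_ex : exists r, r \oc hp (sval M) = lid (sval M).
Proof.
apply: (wp_split_mono W (m := -1)).
exact/wge_0/(svalP M).2.
Qed.

Definition hp_retract := sval (cid hp_retract_ex).

Lemma hp_retractK : hp_retract \oc hp (sval M) = lid (sval M).
Proof. by rewrite /hp_retract; case: cid. Qed.

Definition unit_map (x : F M) : ext (sval M) :=
  cls _ _ (pull (hp_retract \oc hi (sval M)) x).

Lemma unit_cocycle (x : F M) :
  cocycle (sval M) (pull (hp_retract \oc hi (sval M)) x).
Proof. by move=> Q u iu; rewrite -pullM -lcompA iu compm0 pull0. Qed.

Lemma unit_map_bij : bijective unit_map.
Proof.
have [j ej] := hi_lift (hp (sval M)) (heart_le M).
pose P := hP (sval M).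
exists (fun y : ext (sval M) => pull (Q := M) (Q' := P) j (sqval y)) => [x|y].
  have [Q [q [b [qp e]]]] := cls_val (cobound (sval M)) (unit_cocycle x).
  have -> : pull (Q := M) (Q' := P) j (sqval (unit_map x)) =
      pull (Q := M) (Q' := P) j (pull (hp_retract \oc hi (sval M)) x).
    apply/eqP; rewrite -subr_eq0 -linearB e -pullM -lcompA -ej qp pull0.
    by [].
  by rewrite -pullM -lcompA -ej hp_retractK pull1.
have Zy := sqvalP y.
rewrite -[RHS]sqvalK /unit_map -pullM -[RHS](congr1 (cls _ _) (pull1 _)).
apply: covers_cls Zy; last exact: covers1.
exists (hp (sval M) \oc hp_retract).
by rewrite -lcompA hp_retractK lcompm1 !lcompA -ej.
Qed.
End Heart.

Program Definition unit_ntrans : ntrans F (restr (wheart w) ext) :=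
  @NTrans R Hw F (restr (wheart w) ext) unit_map _ _.
Next Obligation.
move=> M a x y; rewrite /unit_map linearP cls_lin //; exact: unit_cocycle.
Qed.
Next Obligation.
move=> M N f y.
have [g cg] := covers_ex (f : mor (sval M) (sval N)).
rewrite [RHS](ext_mapE cg (unit_cocycle y)).
have [x [xp ix]] := cg.
apply/cls_eq.
- exact: unit_cocycle.
- exact: covers_cocycle cg (unit_cocycle y).
have -> : mmor F f y = pull (f : mor (sval M) (sval N)) y by [].
rewrite -!pullM -pullB -(lcompA (hp_retract N)) ix !lcompA -compBm.
pose f0 : mor (sval M) (sval N) := f.
exists N, (f0 \oc hp_retract M - hp_retract N \oc x), y.
split=> //; rewrite compBm -!lcompA hp_retractK xp lcompm1 lcompA.
by rewrite hp_retractK lcomp1m subrr.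
Qed.

Lemma restr_ext : @ciso (modfun_cat Hw) F (restr (wheart w) ext).
Proof.
by apply: (ntrans_ciso (s := unit_ntrans)) => M; apply: unit_map_bij.
Qed.
End Extension.

Lemma restr_yoneda_ess_surj (R : comPzRingType) (C : triangulated R)
    (w : weight_structure C) (t : t_structure C)
    (fg : forall N X : C, theart t N -> wheart w X -> fin_gen (mor X N)) :
  w_bounded w -> saturated C -> right_adjacent w t -> noetherian R ->
  ess_surj (restr_yoneda fg).
Proof.
move=> bw sC wt nR [F fgF]; have [W] := wdecs_ex w.
have [N isoN] : representable (ext W F).
  by apply: (sC (ext W F)).2; apply: ext_finite_type.
have tN : theart t N.
  split.
    apply/wt/wge_0/(@wgeP _ _ _ 0 (-1)) => // X lX.
    exact: (ciso_eq0 isoN (ext_eq0_le lX)).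
  apply: tge0_orth => X [Y tY e]; apply: (ciso_eq0 isoN).
  by apply: ext_eq0_ge; exists Y => //; apply/wt.
exists (exist _ N tN).
apply: (ciso_trans (D := modfun_cat _) (ciso_restr (wheart w) isoN)).
exact/ciso_sym/restr_ext.
Qed.

Theorem proposition3p1p7 (R : comPzRingType) (C : triangulated R)
    (w : weight_structure C) (w_bdd : w_bounded w) :
  (forall (W : wdecs w) (H : modfun C), finite_type H ->
     forall n : int,
       finite_type (tau_leN W n H) /\ finite_type (tau_geN W n H)) /\
  (saturated C ->
     [/\ forall (W : wdecs w) (i : int) (M : C),
           representable (tau_leN W i (yoneda M)) /\
           representable (tau_geN W i (yoneda M)),
         exists t : t_structure C, right_adjacent w t
       & forall t : t_structure C, right_adjacent w t ->
           exists fg : forall N X : C,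
               theart t N -> wheart w X -> fin_gen (mor X N),
             fully_faithful (restr_yoneda fg) /\
             (noetherian R -> ess_surj (restr_yoneda fg))]).
Proof.
split=> [W H fH n|sC].
  by split; [apply: tau_wr_finite_type | apply: tau_geN_finite_type].
have fY (M : C) : finite_type (yoneda M).
  by apply/sC; apply: representable_yoneda.
split.
- move=> W i M; split; apply: (sC _).2.
    exact: tau_wr_finite_type.
  exact: tau_geN_finite_type.
- by have [W] := wdecs_ex w; apply: adjacent_t_structure.
- move=> t wt.
  exists (fun N X _ _ => ((fY N).2 X).1); split; first exact: restr_yoneda_ff.
  exact: restr_yoneda_ess_surj.
Qed.
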